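(* Let $j\in\mathbb N^*$, $n\in\mathbb N^*$, and let $f\in\mathcal Z^{\mathrm{triv}}_{n,\{j\}}$ be such that $f(\theta^{q^i})\ne0$ for some $i>0$. Then one can associate to $f$ a non-trivial $K$-linear dependence relation in $\mathcal L(K)$; namely, there exist $x\in\boldsymbol C_{n,\{j\}}(K)$ and $y\in\boldsymbol C(K)$ with $\lambda_A(x)=\mathcal F_{\{j\}}(f)=\mathcal E_{\{j\}}(f)=\lambda_A(y)$ and $x\neq y$, so that $x-y$ is a non-zero element of the kernel of $\lambda_A:\boldsymbol C(K)\to\mathcal L(K)$.
   Context: Notation. $p$ is a prime, $q=p^e$ with $e\ge1$; $\mathbb N=\mathbb Z_{\ge0}$, $\mathbb N^*=\mathbb Z_{>0}$; $A=\mathbb F_q[\theta]$, $K=\mathbb F_q(\theta)$, $\mathbb C_\infty$ is the completion of an algebraic closure of $K_\infty=\mathbb F_q((1/\theta))$; $A^+$ is the set of monic polynomials of $A$. For $a\in A$, $a(t)\in\mathbb F_q[t]$ is obtained by replacing $\theta$ by $t$. $D_i=\prod_{j=0}^{i-1}(\theta^{q^i}-\theta^{q^j})$, $l_i=\prod_{j=1}^{i}(\theta-\theta^{q^j})$, $D_0=l_0=1$. $\mathfrak S$ is the set of maps $\Sigma:\mathbb N^*\to\mathbb N$ with finite support, with product $(\Sigma\cdot\Sigma')(x)=\Sigma(x)+\Sigma'(x)$ and neutral element $\emptyset$ (the zero map); finite subsets of $\mathbb N^*$ are identified with their characteristic functions. An admissible composition array of $\binom{\Sigma}{n}$ is a matrix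 $\mathcal C=\begin{pmatrix}\Sigma_1&\cdots&\Sigma_r\\ n_1&\cdots&n_r\end{pmatrix}$ with $r\ge1$, $\Sigma_i\in\mathfrak S$, $n_i\in\mathbb N^*$, $\Sigma_1\cdots\Sigma_r=\Sigma$, $\sum n_i=n$; in addition $\binom{\emptyset}{0}$ is admissible. $\boldsymbol C(K)$ is the free $K$-vector space on symbols $[\mathcal C]$, $\mathcal C$ running over all admissible composition arrays, and $\boldsymbol C_{n,\Sigma}(K)$ is the subspace spanned by the $[\mathcal C]$ with $\mathcal C$ an admissible composition array of $\binom{\Sigma}{n}$. $\zeta_A(\mathcal C)=\sum_{a_1,\dots,a_r\in A^+,\ |a_1|>\cdots>|a_r|}\frac{\chi_{\Sigma_1}(a_1)\cdots\chi_{\Sigma_r}(a_r)}{a_1^{n_1}\cdots a_r^{n_r}}$ with $\chi_\Sigma(a)=\prod_i a(t_i)^{\Sigma(i)}$; it is an entire function of the variables $t_i$. $\mathcal Z_{n,\Sigma}$ is the $\mathbb F_p$-span of the $\zeta_A(\mathcal C)$ with $\mathcal C$ admissible of $\binom{\Sigma}{n}$. $\mathcal Z^{\mathrm{triv}}_{n,\{j\}}$ is the set of $f\in\mathcal Z_{n,\{j\}}$, viewed as entire functions of the variable $t_j$, such that $f(\theta^{q^i})=0$ for all but finitely many $i\in\mathbb N$. With $S_d(n)=\sum_{a\in A^+,\deg a=d}a^{-n}$, set $\lambda_A(\mathcal C)=\sum_{d_1>\cdots>d_r\ge0}S_{d_1}(n_1)\cdots S_{d_r}(n_r)\prod_{i\in\mathbb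 N^*}X_i^{\sum_{k=1}^r\Sigma_k(i)q^{d_k}}$, $\lambda_A\binom{\emptyset}{0}=1$. $\mathcal L(K)$ is the $K$-span of all $\lambda_A(\mathcal C)$ with $\mathcal C$ admissible, and $\lambda_A:\boldsymbol C(K)\to\mathcal L(K)$ is the $K$-linear map with $[\mathcal C]\mapsto\lambda_A(\mathcal C)$. For an entire function $f$ of $t_j$: $\mathcal F_{\{j\}}(f)=\sum_{i\ge0}f_iX_j^{q^i}$ with $f_i=\sum_{k=0}^{i}\frac{f(\theta^{q^k})}{D_k\,l_{i-k}^{q^k}}$, and $\mathcal E_{\{j\}}(f)=\sum_{i\ge0}\frac{f(\theta^{q^i})}{D_i}\lambda_A\binom{\{j\}}{1}^{q^i}$, where $\lambda_A\binom{\{j\}}{1}=\sum_{d\ge0}S_d(1)X_j^{q^d}$. *)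

(* Defs.v *)
From HB Require Import structures.
From mathcomp Require Import all_boot all_order all_algebra.
From mathcomp Require Import finmap monalg.
From mathcomp Require Import boolp classical_sets functions cardinality fsbigop.
From mathcomp Require Import reals topology normedtype sequences.

Set Implicit Arguments.
Unset Strict Implicit.
Unset Printing Implicit Defensive.

Import Order.TTheory GRing.Theory Num.Theory.
Import numFieldNormedType.Exports.

Local Open Scope classical_set_scope.
Local Open Scope ring_scope.

Local Notation "x %:F" := (tofrac x).

(* A = {poly Fq}, with the indeterminate 'X in the role of theta. *)
Definition ratK (Fq : finFieldType) : fieldType := {fraction {poly Fq}}.

Definition thetaK (Fq : finFieldType) : ratK Fq := ('X : {poly Fq})%:F.

Definition cvg_abs (R : realType) (L : fieldType) (absv : L -> R)
    (u : nat -> L) (l : L) : Prop :=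
  (fun N => absv (u N - l)) @ \oo --> (0 : R).

Definition cauchy_abs (R : realType) (L : fieldType) (absv : L -> R)
    (u : nat -> L) : Prop :=
  forall eps : R, 0 < eps ->
    exists N, forall i k, (N <= i)%N -> (N <= k)%N -> absv (u i - u k) < eps.

(* The image of Fq((1/theta)) in a complete extension of Fq(theta): the sums
   of the Laurent series in 1/theta with coefficients in Fq. *)
Definition laurent_infty (R : realType) (L : fieldType) (absv : L -> R)
    (Fq : finFieldType) (iota : {rmorphism ratK Fq -> L}) : set L :=
  [set x | exists (N : nat) (c : nat -> Fq),
    cvg_abs absv
      (fun m => \sum_(i < m)
         iota ((c i)%:P%:F * thetaK Fq ^+ N / thetaK Fq ^+ i)) x].

Definition algebraic_over (L : fieldType) (k : set L) : set L :=
  [set x | exists P : {poly L}, [/\ P != 0, forall i, k P`_i & root P x]].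

(* A completion of an algebraic closure of K_oo = Fq((1/theta)), for the
   absolute value with |a| = q^(deg a) on A: a complete ultrametric extension
   of K in which all polynomials over K_oo split, and in which the elements
   algebraic over K_oo (which thus form an algebraic closure of K_oo) are
   dense.  This determines the field up to isometric isomorphism. *)
Record Cinfty (R : realType) (Fq : finFieldType) := MkCinfty {
  Csort :> fieldType;
  Cemb : {rmorphism ratK Fq -> Csort};
  Cabs : Csort -> R;
  Cabs_ge0 : forall x, 0 <= Cabs x;
  Cabs_eq0 : forall x, Cabs x = 0 <-> x = 0;
  CabsM : forall x y, Cabs (x * y) = Cabs x * Cabs y;
  CabsD : forall x y, Cabs (x + y) <= Num.max (Cabs x) (Cabs y);
  Cabs_emb : forall a : {poly Fq}, a != 0 ->
    Cabs (Cemb a%:F) = #|Fq|%:R ^+ (size a).-1;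
  Cabs_complete : forall u : nat -> Csort, cauchy_abs Cabs u ->
    exists l, cvg_abs Cabs u l;
  Cinfty_split : forall P : {poly Csort},
    (forall i, laurent_infty Cabs Cemb P`_i) ->
    exists s : seq Csort, P = lead_coef P *: \prod_(z <- s) ('X - z%:P);
  Cinfty_dense : forall (x : Csort) (eps : R), 0 < eps ->
    exists2 y, algebraic_over (laurent_infty Cabs Cemb) y & Cabs (x - y) < eps
}.

Arguments Cemb {R Fq} c.
Arguments Cabs {R Fq} c x.

Definition theta (R : realType) (Fq : finFieldType) (C : Cinfty R Fq) : C :=
  Cemb C (thetaK Fq).

(* The limit of u if u converges, and 0 otherwise. *)
Definition limC (R : realType) (Fq : finFieldType) (C : Cinfty R Fq)
    (u : nat -> C) : C :=
  xget 0 [set l | cvg_abs (Cabs C) u l].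

Definition Dcarlitz (Fq : finFieldType) (i : nat) : ratK Fq :=
  \prod_(0 <= k < i) (thetaK Fq ^+ (#|Fq| ^ i) - thetaK Fq ^+ (#|Fq| ^ k)).

Definition lcarlitz (Fq : finFieldType) (i : nat) : ratK Fq :=
  \prod_(1 <= k < i.+1) (thetaK Fq - thetaK Fq ^+ (#|Fq| ^ k)).

(* The positive integers, which also index the variables t_i and X_i. *)
Definition posn := {n : nat | (0 < n)%N}.
Definition posn_nat (n : posn) : nat := val n.
Coercion posn_nat : posn >-> nat.
HB.instance Definition _ := Choice.on posn.

(* The monoid S of the finitely supported maps is {cmonom posn}; the finite
   set {j} is the monomial ucm j.  An array is the sequence of its columns
   (Sigma_k, n_k); the array of the empty type and of weight 0 is [::]. *)
Definition array := seq ({cmonom posn} * posn).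
HB.instance Definition _ := Choice.on array.

Definition admissible (Sg : {cmonom posn}) (n : nat) (c : array) : Prop :=
  \big[mmul/mone]_(col <- c) col.1 = Sg /\ (\sum_(col <- c) col.2)%N = n.

Definition column (c : array) (k : 'I_(size c)) : {cmonom posn} * posn :=
  tnth (in_tuple c) k.

Definition CK (Fq : finFieldType) := {malg (ratK Fq)[array]}.

Definition CK_sub (Fq : finFieldType) (n : nat) (Sg : {cmonom posn}) :
    set (CK Fq) :=
  [set x | exists (m : nat) (b : 'I_m -> ratK Fq) (c : 'I_m -> array),
    (forall i, admissible Sg n (c i)) /\ x = \sum_(i < m) b i *: << c i >>].

Definition chi (R : realType) (Fq : finFieldType) (C : Cinfty R Fq)
    (Sg : {cmonom posn}) (a : {poly Fq}) (t : posn -> C) : C :=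
  \prod_(i <- finsupp Sg)
    (map_poly (fun b : Fq => Cemb C b%:P%:F) a).[t i] ^+ Sg i.

(* The sum over the a_k is the limit of the finite sums over deg a_k < N: its
   terms are grouped by degree, so that it converges for all t.  The condition
   |a_1| > ... > |a_r| is expressed with sizes, that is, degrees plus one. *)
Definition zetaA (R : realType) (Fq : finFieldType) (C : Cinfty R Fq)
    (c : array) (t : posn -> C) : C :=
  limC (fun N =>
    \sum_(a : (size c).-tuple {poly_N Fq} |
            [forall k, (tnth a k : {poly Fq}) \is monic] &&
            sorted (fun b b' : {poly_N Fq} => (size b' < size b)%N) a)
      \prod_(k < size c)
        (chi (column k).1 (tnth a k) t
         / Cemb C (tnth a k : {poly Fq})%:F ^+ (column k).2)).

(* The Fp-span; a residue acts through its representative in nat. *)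
Definition Zspan (R : realType) (Fq : finFieldType) (C : Cinfty R Fq)
    (p n : nat) (Sg : {cmonom posn}) : set ((posn -> C) -> C) :=
  [set f | exists (m : nat) (b : 'I_m -> 'F_p) (c : 'I_m -> array),
    (forall i, admissible Sg n (c i)) /\
    f = (fun t => \sum_(i < m) (b i : nat)%:R * zetaA (c i) t)].

(* The elements of Zspan p n {j} only depend on t_j. *)
Definition fun_of_var (R : realType) (Fq : finFieldType) (C : Cinfty R Fq)
    (j : posn) (g : (posn -> C) -> C) : C -> C :=
  fun z => g (fun i => if i == j then z else 0).

Definition Ztriv (R : realType) (Fq : finFieldType) (C : Cinfty R Fq)
    (p n : nat) (j : posn) : set (C -> C) :=
  [set f | (exists2 g, Zspan p n (ucm j) g & f = fun_of_var j g) /\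
     finite_set [set i : nat | f (theta C ^+ (#|Fq| ^ i)) != 0]].

(* Formal power series in the X_i, as families of coefficients. *)
Definition series (R : realType) (Fq : finFieldType) (C : Cinfty R Fq) :=
  {cmonom posn} -> C.

Definition smonom (R : realType) (Fq : finFieldType) (C : Cinfty R Fq)
    (mu : {cmonom posn}) : series C :=
  fun nu => (nu == mu)%:R.

Definition smul (R : realType) (Fq : finFieldType) (C : Cinfty R Fq)
    (g h : series C) : series C :=
  fun nu => \sum_(ab \in [set ab : {cmonom posn} * {cmonom posn} |
                            mmul ab.1 ab.2 = nu]) (g ab.1 * h ab.2).

Definition spow (R : realType) (Fq : finFieldType) (C : Cinfty R Fq)
    (g : series C) (k : nat) : series C :=
  iter k (smul g) (smonom C mone).

(* The sum of infinitely many series, coefficientwise. *)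
Definition ssum (R : realType) (Fq : finFieldType) (C : Cinfty R Fq)
    (u : nat -> series C) : series C :=
  fun nu => limC (fun N => \sum_(i < N) u i nu).

Definition powersum (Fq : finFieldType) (d n : nat) : ratK Fq :=
  \sum_(a : {poly_d.+1 Fq} |
          ((a : {poly Fq}) \is monic) && (size a == d.+1))
    (a : {poly Fq})%:F ^- n.

Definition lambdaA (R : realType) (Fq : finFieldType) (C : Cinfty R Fq)
    (c : array) : series C :=
  fun nu => limC (fun N =>
    \sum_(d : (size c).-tuple 'I_N |
            sorted (fun i i' : 'I_N => (i' < i)%N) d)
      Cemb C (\prod_(k < size c) powersum Fq (tnth d k) (column k).2)
      * smonom C (\big[mmul/mone]_(k < size c)
                    expcmn (column k).1 (#|Fq| ^ tnth d k)) nu).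

Definition LK (R : realType) (Fq : finFieldType) (C : Cinfty R Fq) :
    set (series C) :=
  [set g | exists (m : nat) (b : 'I_m -> ratK Fq) (c : 'I_m -> array),
    g = (fun nu => \sum_(i < m) Cemb C (b i) * lambdaA C (c i) nu)].

(* The K-linear map C(K) -> L(K) with [c] |-> lambdaA c. *)
Definition lambdaK (R : realType) (Fq : finFieldType) (C : Cinfty R Fq)
    (x : CK Fq) : series C :=
  fun nu => \sum_(c <- msupp x) Cemb C (x@_c) * lambdaA C c nu.

Definition Fcoef (R : realType) (Fq : finFieldType) (C : Cinfty R Fq)
    (f : C -> C) (i : nat) : C :=
  \sum_(k < i.+1) f (theta C ^+ (#|Fq| ^ k))
    / Cemb C (Dcarlitz Fq k * lcarlitz Fq (i - k) ^+ (#|Fq| ^ k)).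

Definition calF (R : realType) (Fq : finFieldType) (C : Cinfty R Fq)
    (j : posn) (f : C -> C) : series C :=
  ssum (fun i nu => Fcoef f i * smonom C (expcmn (ucm j) (#|Fq| ^ i)) nu).

Definition posn1 : posn := exist _ 1%N isT.

Definition calE (R : realType) (Fq : finFieldType) (C : Cinfty R Fq)
    (j : posn) (f : C -> C) : series C :=
  ssum (fun i nu =>
    f (theta C ^+ (#|Fq| ^ i)) / Cemb C (Dcarlitz Fq i)
    * spow (lambdaA C [:: (ucm j, posn1)]) (#|Fq| ^ i) nu).

Lemma lambdaK_basis (R : realType) (Fq : finFieldType) (C : Cinfty R Fq)
  (c : array) : lambdaK C (<< c >> : CK Fq) = lambdaA C c.
Proof.
apply/funext => nu; rewrite /lambdaK msuppU oner_eq0 big_seq_fset1.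
by rewrite mcoeffUU rmorph1 mul1r.
Qed.

Lemma lambdaK_linear (R : realType) (Fq : finFieldType) (C : Cinfty R Fq)
  (b : ratK Fq) (x y : CK Fq) :
  lambdaK C (b *: x + y) =
  (fun nu => Cemb C b * lambdaK C x nu + lambdaK C y nu).
Proof.
have E (D : {fset array}) (z : CK Fq) nu : (msupp z `<=` D)%fset ->
    lambdaK C z nu = \sum_(c <- D) Cemb C z@_c * lambdaA C c nu.
  move=> zD; rewrite /lambdaK; apply/esym.
  rewrite (big_fset_incl _ zD) // => c _ /mcoeff_outdom->.
  by rewrite rmorph0 mul0r.
apply/funext => nu.
pose D := (msupp x `|` msupp y `|` msupp (b *: x + y))%fset.
rewrite !(E D) ?fsubsetUr //; last first.
- by rewrite /D -fsetUA fsubsetUl.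
- by rewrite /D fsetUAC fsubsetUr.
rewrite big_distrr -big_split; apply: eq_bigr => c _ /=.
by rewrite mcoeffD mcoeffZ rmorphD rmorphM mulrDl mulrA.
Qed.

Lemma range_lambdaK (R : realType) (Fq : finFieldType) (C : Cinfty R Fq) :
  range (lambdaK C) = @LK R Fq C.
Proof.
apply/seteqP; split=> [_ [x _ <-]|_ [m [b [c ->]]]].
- exists (size (msupp x)), (fun i => x@_(tnth (in_tuple (msupp x)) i)).
  exists (tnth (in_tuple (msupp x))); apply/funext => nu.
  by rewrite /lambdaK big_tnth.
- exists (\sum_(i < m) b i *: << c i >>) => //; apply/funext => nu.
  elim: m b c => [|m IHm] b c.
    by rewrite /lambdaK !big_ord0 msupp0 big_seq_fset0.
  by rewrite !big_ord_recl lambdaK_linear lambdaK_basis IHm.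
Qed.

(* Main.v *)
Require Import Defs.
From HB Require Import structures.
From mathcomp Require Import all_boot all_order all_algebra all_field.
From mathcomp Require Import finmap monalg ring lra zify.
From mathcomp Require Import boolp classical_sets functions cardinality fsbigop.
From mathcomp Require Import reals topology normedtype sequences.

Set Implicit Arguments.
Unset Strict Implicit.
Unset Printing Implicit Defensive.

Import Order.TTheory GRing.Theory Num.Theory.
Import numFieldNormedType.Exports.

Local Open Scope classical_set_scope.
Local Open Scope ring_scope.

Local Notation "x %:F" := (tofrac x).

(** Write q for the cardinality of Fq, S_d(n) for the sum of a^-n over the monic
    polynomials a of degree d, and call letter a column (Sigma, n) of an array.

    The transform F only sees the values of f at the points t_j = theta^(q^k),
    where a(t_j) becomes a^(q^k).  Its coefficient of X_j^(q^i) thus replaces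
    a(t_j) in the zeta functions by E_i(a), where E_i is the F_q-linear polynomial
    E_i(z) = \sum_k z^(q^k) / (D_k l_(i-k)^(q^k)), which vanishes on the polynomials
    of degree < i and is 1 on the monic polynomials of degree i
    (carlitzE_small, carlitzE_monic).  The letter of weight m that carries t_j
    then contributes, in degree d, the sum of E_i(a) / a^m over the monic a of
    degree d: this is 0 if d < i, the letter S_i(m) of lambda_A if d = i, and
    \sum_(q^k < m) S_d(m - q^k) / (D_k l_(i-k)^(q^k)) if d > i
    (sum_ecoef_mixsum).  The coefficient 1 / (D_k l_(i-k)^(q^k)) is itself, up to
    sign, the nested power sum of leading degree i with weights 1, q - 1,
    q (q - 1), ..., q^(k-1) (q - 1), whose total is q^k (ecoef_nest).  So the case
    d > i produces products of nested sums of total weight m, and these are again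
    combinations of nested sums (nspan_nest_mul), by Chen's formula for the product
    of two power sums of the same degree (psum_mul).  This yields x, of type {j}
    and of weight n (F_zeta_span, calF_lambdaK).

    All these identities hold for the sums over degrees < N, whatever N is;
    limits are only taken at the end, and they exist because S_d(n) tends to 0.

    The q^k-th power of lambda_A({j}; 1) is lambda_A(q^k {j}; q^k) by Frobenius,
    since S_d(1)^(q^k) = S_d(q^k); as S_d(1) = 1 / l_d, comparing coefficients
    gives F(f) = E(f) (calF_calE).  The value f(theta^(q^k)) need not be in K, but
    it is a K-linear combination of multiple zeta values (nest_zetacol_span), so
    its product with lambda_A(q^k {j}; q^k) is a K-linear combination of
    lambda_A(c) with c of type q^k {j}, and the finitely many nonzero values give y
    (calE_lambdaK).  The arrays of x have type {j}, while the part of y of type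
    q^k {j} does not vanish if f(theta^(q^k)) <> 0; taking k > 0, x <> y. *)

(** * Frobenius *)

Lemma card_pchar_nat (Fq : finFieldType) (S : comNzRingType)
  (g : {rmorphism Fq -> S}) k : [pchar S].-nat (#|Fq| ^ k)%N.
Proof.
have [p p_pr pF] := finPcharP Fq.
rewrite (card_pprimeChar pF) pnatX; apply/orP; left; rewrite pnatX.
by rewrite pnatE // (rmorph_pchar g pF).
Qed.

Lemma card_gt1 (Fq : finFieldType) : (1 < #|Fq|)%N.
Proof. exact: finNzRing_gt1. Qed.

Lemma expq_gt0 (Fq : finFieldType) k : (0 < #|Fq| ^ k)%N.
Proof. by rewrite expn_gt0 ltnW ?card_gt1. Qed.

Lemma ltn_expq (Fq : finFieldType) k i : (#|Fq| ^ k < #|Fq| ^ i)%N = (k < i)%N.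
Proof. exact: ltn_exp2l (card_gt1 Fq). Qed.

Lemma leq_expq (Fq : finFieldType) k i : (#|Fq| ^ k <= #|Fq| ^ i)%N = (k <= i)%N.
Proof. exact: leq_exp2l (card_gt1 Fq). Qed.

Lemma frobenius_sum (Fq : finFieldType) (S : comNzRingType)
  (g : {rmorphism Fq -> S}) k (I : Type) (r : seq I) (Q : pred I) (F : I -> S) :
  (\sum_(i <- r | Q i) F i) ^+ (#|Fq| ^ k) = \sum_(i <- r | Q i) F i ^+ (#|Fq| ^ k).
Proof.
apply: (big_morph (fun x : S => x ^+ (#|Fq| ^ k))) => [x y|].
  exact/exprDn_pchar/(card_pchar_nat g).
by rewrite expr0n gtn_eqF ?expq_gt0.
Qed.

(** * Monic polynomials *)

Section Monics.
Variable Fq : finFieldType.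
Local Notation q := #|Fq|.

Definition monics d : seq {poly Fq} :=
  [seq 'X^d + val b | b <- enum {poly_d Fq}].

Lemma size_monics d : size (monics d) = (q ^ d)%N.
Proof. by rewrite size_map -cardE card_npoly. Qed.

Lemma uniq_monics d : uniq (monics d).
Proof. by rewrite map_inj_uniq ?enum_uniq// => x y /addrI /val_inj. Qed.

Lemma mem_monics d a : (a \in monics d) = (a \is monic) && (size a == d.+1).
Proof.
apply/mapP/andP => [[b _ ->]|[a_mon /eqP sa]].
  have sb : (size (val b : {poly Fq}) < size ('X^d : {poly Fq}))%N.
    by rewrite size_polyXn ltnS size_npoly.
  by rewrite monicE lead_coefDl// size_polyDl// size_polyXn lead_coefXn.
have sa' : (size (a - 'X^d)%R <= d)%N.
  apply/leq_sizeP => i; rewrite leq_eqVlt coefB coefXn => /predU1P[<-|di].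
    by rewrite eqxx -[X in a`_X]/(d.+1.-1) -sa -lead_coefE (monicP a_mon) subrr.
  by rewrite gtn_eqF// subr0 nth_default// sa.
exists (npolyp d (a - 'X^d)); first by rewrite mem_enum.
by rewrite /= npolypK// subrKC.
Qed.

Lemma monics_neq0 d a : a \in monics d -> a != 0.
Proof. by rewrite mem_monics => /andP[/monic_neq0]. Qed.

(** The sums over the polynomials of bounded size only depend on the bound
    through the degrees that it allows. *)
Lemma sum_monics (V : nmodType) N d (h : {poly Fq} -> V) : (d < N)%N ->
  \sum_(a : {poly_N Fq} | ((a : {poly Fq}) \is monic) && (size a == d.+1))
     h (a : {poly Fq})
  = \sum_(a <- monics d) h a.
Proof.
move=> dN; rewrite -[LHS]big_filter -[LHS](big_map val xpredT h).
apply: perm_big; apply: uniq_perm => [||a]; rewrite ?uniq_monics//.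
  by rewrite (map_inj_uniq val_inj) filter_uniq// index_enum_uniq.
rewrite mem_monics; apply/mapP/idP => [[b]|/andP[a_mon /eqP sa]].
  by rewrite mem_filter => /andP[bP _] ->.
exists (npolyp N a); last by rewrite /= npolypK// sa.
by rewrite mem_filter mem_index_enum /= npolypK ?sa// a_mon eqxx.
Qed.

End Monics.

(** * Lagrange interpolation *)

Section Interpolation.
Variable K : fieldType.

Lemma prod_XsubC_rem (s : seq K) (a : K) : a \in s ->
  \prod_(b <- s) ('X - b%:P) =
  ('X - a%:P) * \prod_(b <- rem a s) ('X - b%:P).
Proof. by move=> a_s; rewrite (perm_big _ (perm_to_rem a_s)) big_cons. Qed.

(** The Lagrange interpolation polynomial of P at s has
    \sum_(a <- s) P.[a] / W^`().[a] as its top coefficient, W being the product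
    of the X - a. *)
Lemma sum_horner_roots (s : seq K) (w : K) (P : {poly K}) : uniq s ->
  (\prod_(b <- s) ('X - b%:P))^`() = w%:P -> (size P <= size s)%N ->
  \sum_(a <- s) P.[a] = w * P`_(size s).-1.
Proof.
move=> s_uniq W' sP.
pose L := \sum_(a <- s) P.[a] *: \prod_(b <- rem a s) ('X - b%:P).
have sizeL a : a \in s ->
    size (\prod_(b <- rem a s) ('X - b%:P) : {poly K}) = size s.
  move=> a_s; rewrite size_prod_XsubC size_rem// prednK//.
  by case: (s) a_s.
(* both sides have size <= size s and take the same values on s *)
have LE : L = w *: P.
  apply/eqP; rewrite -subr_eq0; apply/eqP; apply: (roots_geq_poly_eq0 _ s_uniq).
    apply/allP => a a_s; rewrite rootE hornerD hornerN hornerZ subr_eq0 horner_sum.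
    rewrite (perm_big _ (perm_to_rem a_s)) big_cons.
    have -> : \sum_(b <- rem a s)
        (P.[b] *: \prod_(c <- rem b s) ('X - c%:P)).[a] = 0.
      rewrite big_seq big1// => b; rewrite mem_rem_uniq// => /andP[/= ba _].
      rewrite hornerZ (@prod_XsubC_rem _ a) ?hornerM.
        by rewrite hornerXsubC subrr mul0r mulr0.
      by rewrite mem_rem_uniq// inE/= eq_sym ba.
    have := congr1 (horner^~ a) W'.
    rewrite (prod_XsubC_rem a_s) derivM derivXsubC mul1r hornerD hornerM.
    rewrite hornerXsubC subrr mul0r !addr0 hornerC hornerZ => ->.
    by rewrite /= addr0 mulrC.
  apply: leq_trans (size_polyD _ _) _; rewrite geq_max size_polyN.
  rewrite (leq_trans (size_scale_leq _ _) sP) andbT.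
  apply: leq_trans (size_sum _ _ _) _; apply/bigmax_leqP_seq => a a_s _.
  by rewrite (leq_trans (size_scale_leq _ _))// sizeL.
rewrite -coefZ -LE coef_sum; apply: eq_big_seq => a a_s; rewrite coefZ.
have /monicP := monic_prod_XsubC (rem a s) xpredT id.
by rewrite lead_coefE sizeL// => ->; rewrite mulr1.
Qed.

End Interpolation.

(** * The polynomials E_i and the power sums *)

Section Carlitz.
Variables (Fq : finFieldType) (K : fieldType) (iota : {rmorphism {poly Fq} -> K}).
Hypothesis iota_inj : injective iota.
Local Notation q := #|Fq|.
Local Notation theta := (iota 'X).

Definition constK : {rmorphism Fq -> K} := iota \o polyC.

Definition carlitzD i : K :=
  \prod_(0 <= k < i) (theta ^+ (q ^ i) - theta ^+ (q ^ k)).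

Definition carlitzL i : K :=
  \prod_(1 <= k < i.+1) (theta - theta ^+ (q ^ k)).

Definition psum d n : K := \sum_(a <- monics Fq d) iota a ^- n.

Lemma iota_eq0 a : (iota a == 0) = (a == 0).
Proof. by rewrite -(rmorph0 iota) (inj_eq iota_inj). Qed.

Lemma frobD k (x y : K) : (x + y) ^+ (q ^ k) = x ^+ (q ^ k) + y ^+ (q ^ k).
Proof. exact/exprDn_pchar/(card_pchar_nat constK). Qed.

Lemma frobN k (x : K) : (- x) ^+ (q ^ k) = - x ^+ (q ^ k).
Proof. exact/exprNn_pchar/(card_pchar_nat constK). Qed.

Lemma frobB k (x y : K) : (x - y) ^+ (q ^ k) = x ^+ (q ^ k) - y ^+ (q ^ k).
Proof. by rewrite frobD frobN. Qed.

Lemma frob_const k (c : Fq) : c ^+ (q ^ k) = c.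
Proof. by elim: k => [|k IHk]; rewrite ?expr1// expnS exprM expf_card. Qed.

Lemma thetaB_neq0 m n : m != n -> theta ^+ m - theta ^+ n != 0.
Proof.
move=> mn; rewrite subr_eq0 -!rmorphXn (inj_eq iota_inj).
apply: contra mn => /eqP /(congr1 (size : {poly Fq} -> nat)).
by rewrite !size_polyXn => -[->].
Qed.

Lemma thetaX1B_neq0 k : theta ^+ (q ^ k.+1) - theta != 0.
Proof.
have := @thetaB_neq0 (q ^ k.+1)%N 1%N; rewrite expr1; apply.
by rewrite gtn_eqF // -(expn0 q) ltn_expq.
Qed.

Lemma carlitzDS i :
  carlitzD i.+1 = (theta ^+ (q ^ i.+1) - theta) * carlitzD i ^+ q.
Proof.
rewrite /carlitzD big_nat_recl// expn0 expr1 -prodrXl; congr (_ * _).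
apply: eq_bigr => k _; have := frobB 1 (theta ^+ (q ^ i)) (theta ^+ (q ^ k)).
by rewrite expn1 -!exprM -!expnSr => ->.
Qed.

Lemma carlitzLS i :
  carlitzL i.+1 = carlitzL i * (theta - theta ^+ (q ^ i.+1)).
Proof. by rewrite /carlitzL big_nat_recr. Qed.

Lemma carlitzL0 : carlitzL 0 = 1.
Proof. by rewrite /carlitzL big_geq. Qed.

Lemma carlitzD0 : carlitzD 0 = 1.
Proof. by rewrite /carlitzD big_geq. Qed.

Lemma carlitzD_neq0 i : carlitzD i != 0.
Proof.
elim: i => [|i IHi]; first by rewrite carlitzD0 oner_neq0.
by rewrite carlitzDS mulf_neq0 ?thetaX1B_neq0 ?expf_neq0.
Qed.

Lemma carlitzL_neq0 i : carlitzL i != 0.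
Proof.
elim: i => [|i IHi]; first by rewrite carlitzL0 oner_neq0.
by rewrite carlitzLS mulf_neq0// -opprB oppr_eq0 thetaX1B_neq0.
Qed.

(** The coefficient of z^(q^k) in E_i(z) = e_i(z) / D_i, where e_i is the
    product of the z - b over the polynomials b of degree < i. *)
Definition ecoef k i : K :=
  if (k <= i)%N then (carlitzD k * carlitzL (i - k) ^+ (q ^ k))^-1 else 0.

Lemma ecoef_out k i : (i < k)%N -> ecoef k i = 0.
Proof. by rewrite /ecoef ltnNge => /negbTE->. Qed.

(** This identity and ecoef_step are the two ways of comparing E_i and E_(i+1),
    coefficient by coefficient. *)
Lemma ecoef_frob k i :
  ecoef k.+1 i.+1 * (theta ^+ (q ^ k.+1) - theta) = ecoef k i ^+ q.
Proof.
rewrite /ecoef ltnS; case: leqP => _; last first.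
  by rewrite mul0r expr0n gtn_eqF// ltnW// card_gt1.
rewrite subSS carlitzDS exprVn exprMn -exprM -expnSr -mulrA invfM.
by rewrite mulrAC mulVf ?mul1r ?thetaX1B_neq0.
Qed.

Lemma ecoef_step k i :
  ecoef k i = ecoef k i.+1 * (theta ^+ (q ^ k) - theta ^+ (q ^ i.+1)).
Proof.
rewrite /ecoef; case: (ltngtP k i.+1) => [ki|ki|->]; first last.
- by rewrite ltnn subrr mulr0.
- by rewrite leqNgt (leq_trans _ ki)// mul0r.
rewrite -ltnS ki subSn// carlitzLS exprMn frobB -exprM -expnD addSn subnK//.
rewrite mulrA [in RHS]invfM mulfVK// thetaB_neq0//.
by rewrite ltn_eqF// ltn_expq.
Qed.

Definition carlitzE i (z : K) : K := \sum_(k < i.+1) ecoef k i * z ^+ (q ^ k).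

(** Multiplication by theta on the argument and on the value differ by a
    Frobenius, which allows the values at the powers of theta to be computed by
    induction. *)
Lemma carlitzE_theta i (z : K) :
  carlitzE i.+1 (theta * z) = theta * carlitzE i.+1 z + carlitzE i z ^+ q.
Proof.
suff <- : carlitzE i.+1 (theta * z) - theta * carlitzE i.+1 z = carlitzE i z ^+ q.
  by rewrite addrC subrK.
rewrite /carlitzE mulr_sumr -sumrB big_ord_recl /= expn0 !expr1.
rewrite (_ : ecoef 0 _ * _ - _ = 0) ?add0r; last by ring.
rewrite -[in RHS](expn1 q) (frobenius_sum constK) expn1; apply: eq_bigr => k _.
rewrite /bump add1n !exprMn -exprM -expnSr -ecoef_frob; ring.
Qed.

Lemma carlitzE_step i (z : K) :
  (theta ^+ (q ^ i.+1) - theta) * carlitzE i.+1 z = carlitzE i z ^+ q - carlitzE i z.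
Proof.
have -> : carlitzE i z ^+ q = carlitzE i.+1 (theta * z) - theta * carlitzE i.+1 z.
  by rewrite carlitzE_theta addrC addKr.
have -> : carlitzE i z = \sum_(k < i.+2) ecoef k i * z ^+ (q ^ k).
  by rewrite [RHS]big_ord_recr/= ecoef_out// mul0r addr0.
rewrite /carlitzE !mulr_sumr -!sumrB; apply: eq_bigr => k _.
by rewrite exprMn [ecoef k i]ecoef_step; ring.
Qed.

Lemma carlitzED i (x y : K) : carlitzE i (x + y) = carlitzE i x + carlitzE i y.
Proof. by rewrite -big_split; apply: eq_bigr => k _; rewrite frobD mulrDr. Qed.

Lemma carlitzEZ i c (x : K) : carlitzE i (constK c * x) = constK c * carlitzE i x.
Proof.
rewrite mulr_sumr; apply: eq_bigr => k _.
by rewrite exprMn -rmorphXn frob_const mulrCA.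
Qed.

Lemma carlitzE_sum i (I : Type) (r : seq I) (P : pred I) (F : I -> K) :
  carlitzE i (\sum_(j <- r | P j) F j) = \sum_(j <- r | P j) carlitzE i (F j).
Proof.
apply: (big_morph (carlitzE i) (carlitzED i)); rewrite /carlitzE big1// => k _.
by rewrite expr0n gtn_eqF ?expq_gt0// mulr0.
Qed.

Lemma carlitzE0 (x : K) : carlitzE 0 x = x.
Proof.
rewrite /carlitzE big_ord1 /ecoef leqnn carlitzD0 carlitzL0 expr1n mulr1 invr1 mul1r.
by rewrite expn0 expr1.
Qed.

(** E_i(1) = 0 for i > 0 by carlitzE_step, because 1 ^+ q = 1, and carlitzE_theta
    then goes from theta^j to theta^(j+1). *)
Lemma carlitzE_thetaX i j : (j <= i)%N -> carlitzE i (theta ^+ j) = (i == j)%:R.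
Proof.
elim: i j => [|i IHi] j; first by rewrite leqn0 => /eqP->; rewrite carlitzE0.
elim: j => [_|j IHj].
  have := carlitzE_step i 1.
  rewrite -[X in carlitzE i X](expr0 theta) IHi// -(expr0 theta) => /esym.
  case: eqP => _; rewrite /= ?expr1n ?expr0n ?gtn_eqF ?(ltnW (card_gt1 Fq))//;
    rewrite subrr => /esym/eqP; rewrite mulf_eq0 => /orP[|/eqP->]//;
    by rewrite (negPf (thetaX1B_neq0 i)).
rewrite ltnS exprS carlitzE_theta eqSS => ji; rewrite IHi// IHj ?leqW//.
rewrite gtn_eqF ?ltnS// mulr0 add0r.
by case: eqP => _; rewrite ?expr1n// expr0n gtn_eqF// ltnW// card_gt1.
Qed.

Lemma polyK_sum n (a : {poly Fq}) : (size a <= n)%N ->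
  iota a = \sum_(j < n) constK a`_j * theta ^+ j.
Proof.
move=> an; rewrite -{1}[a]coefK poly_def rmorph_sum/=.
rewrite (big_ord_widen _ (fun j => iota (a`_j *: 'X^j)) an) big_mkcond.
apply: eq_bigr => j _; rewrite -mul_polyC rmorphM rmorphXn.
by case: ltnP => // aj; rewrite nth_default// rmorph0 mul0r.
Qed.

Lemma carlitzE_poly i (a : {poly Fq}) : (size a <= i.+1)%N ->
  carlitzE i (iota a) = constK a`_i.
Proof.
move=> ai; rewrite (polyK_sum ai) carlitzE_sum (bigD1 ord_max)//=.
rewrite carlitzEZ carlitzE_thetaX// eqxx mulr1 big1 ?addr0// => j.
rewrite -val_eqE/= => ji.
by rewrite carlitzEZ carlitzE_thetaX ?leq_ord// eq_sym (negPf ji) mulr0.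
Qed.

Lemma carlitzE_monic i (a : {poly Fq}) : a \in monics Fq i ->
  carlitzE i (iota a) = 1.
Proof.
rewrite mem_monics => /andP[/monicP a_mon /eqP sa].
by rewrite carlitzE_poly ?sa// -[i]/(i.+1.-1) -sa -lead_coefE a_mon rmorph1.
Qed.

Lemma carlitzE_small i (a : {poly Fq}) : (size a <= i)%N ->
  carlitzE i (iota a) = 0.
Proof. by move=> ai; rewrite carlitzE_poly ?leqW// nth_default// rmorph0. Qed.

Lemma natr_expqS k : (q ^ k.+1)%:R = 0 :> K.
Proof.
have [p p_pr pF] := finPcharP Fq.
rewrite expnS natrM (_ : q%:R = 0) ?mul0r//.
rewrite -(rmorph_nat constK) (card_pprimeChar pF) natrX pcharf0//.
rewrite expr0n; case: eqP => [n0|_]; last by rewrite rmorph0.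
by have := card_gt1 Fq; rewrite (card_pprimeChar pF) n0.
Qed.

Definition monicsK d : seq K := [seq iota a | a <- monics Fq d].

Lemma uniq_monicsK d : uniq (monicsK d).
Proof.
by rewrite (map_inj_uniq iota_inj) uniq_monics.
Qed.

Lemma size_monicsK d : size (monicsK d) = (q ^ d)%N.
Proof. by rewrite size_map size_monics. Qed.

(** E_i - 1 has degree q^i and vanishes at the q^i monic polynomials of degree i.
    So the product over the latter has constant derivative, which is what
    sum_horner_roots needs. *)
Lemma prod_monicsK d :
  \prod_(b <- monicsK d) ('X - b%:P) =
  carlitzD d *: (\sum_(k < d.+1) ecoef k d *: 'X^(q ^ k) - 1).
Proof.
pose W : {poly K} := \sum_(k < d.+1) ecoef k d *: 'X^(q ^ k) - 1.
have edd : ecoef d d = (carlitzD d)^-1.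
  by rewrite /ecoef leqnn subnn carlitzL0 expr1n mulr1.
have sW0 : (size (\sum_(k < d) ecoef k d *: 'X^(q ^ k) - 1 : {poly K})%R
    < (q ^ d).+1)%N.
  rewrite ltnS (leq_trans (size_polyD _ _))// geq_max size_polyN size_poly1.
  rewrite expq_gt0 andbT (leq_trans (size_sum _ _ _))//.
  apply/bigmax_leqP => k _; rewrite (leq_trans (size_scale_leq _ _))//.
  by rewrite size_polyXn ltn_expq.
have sWd : size (ecoef d d *: 'X^(q ^ d) : {poly K}) = (q ^ d).+1.
  by rewrite size_scale ?size_polyXn// edd invr_eq0 carlitzD_neq0.
have WE : W = ecoef d d *: 'X^(q ^ d)
              + (\sum_(k < d) ecoef k d *: 'X^(q ^ k) - 1).
  by rewrite /W big_ord_recr/= addrAC addrC.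
have sW : size W = (q ^ d).+1 by rewrite WE size_polyDl sWd.
have lW : lead_coef W = (carlitzD d)^-1.
  by rewrite WE lead_coefDl ?sWd// lead_coefZ lead_coefXn mulr1.
have := @all_roots_prod_XsubC _ W (monicsK d).
rewrite -/W size_monicsK sW lW => WP; rewrite [X in _ *: X]WP//.
- by rewrite scalerA divff ?scale1r// carlitzD_neq0.
- apply/allP => _ /mapP[a a_mon ->]; rewrite rootE !hornerE horner_sum subr_eq0.
  rewrite -(carlitzE_monic a_mon) /carlitzE; apply/eqP/eq_bigr => k _.
  by rewrite hornerZ hornerXn.
- by rewrite uniq_rootsE uniq_monicsK.
Qed.

Lemma deriv_prod_monicsK d :
  (\prod_(b <- monicsK d) ('X - b%:P))^`() =
  (carlitzD d / carlitzL d)%:P.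
Proof.
rewrite prod_monicsK derivZ derivB derivC subr0 (raddf_sum (@deriv K)) big_ord_recl/=.
rewrite big1 ?addr0 => [|k _].
  rewrite derivZ expn0 expr1 derivX /ecoef leq0n carlitzD0 subn0 expr1 mul1r.
  by rewrite alg_polyC -mul_polyC -polyCM.
by rewrite derivZ derivXn /bump add1n -mulr_natl -(rmorph_nat polyC)
  natr_expqS mul0r scaler0.
Qed.

Lemma sum_monics_horner d (P : {poly K}) : (size P <= q ^ d)%N ->
  \sum_(a <- monics Fq d) P.[iota a] =
  carlitzD d / carlitzL d * P`_(q ^ d).-1.
Proof.
move=> sP; rewrite -(big_map iota xpredT (fun x => P.[x])).
rewrite -(size_monicsK d).
by apply: sum_horner_roots; rewrite ?uniq_monicsK ?deriv_prod_monicsK// size_monicsK.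
Qed.

Lemma sum_monics_expr_eq0 d m : (m < (q ^ d).-1)%N ->
  \sum_(a <- monics Fq d) iota a ^+ m = 0 :> K.
Proof.
move=> md; have := @sum_monics_horner d 'X^m.
rewrite size_polyXn coefXn gtn_eqF// mulr0 => H; apply: etrans (H _).
  by apply: eq_bigr => a _; rewrite hornerXn.
by rewrite (leq_trans md)// leq_pred.
Qed.

Lemma sum_monics_expr_top d :
  \sum_(a <- monics Fq d) iota a ^+ (q ^ d).-1 =
  carlitzD d / carlitzL d :> K.
Proof.
have := @sum_monics_horner d ('X^((q ^ d).-1)).
rewrite size_polyXn coefXn eqxx mulr1 prednK ?expq_gt0// => <-//.
by apply: eq_bigr => a _; rewrite hornerXn.
Qed.

(** The power sum of exponent m - n, which may have either sign. *)
Definition mixsum d m n : K :=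
  \sum_(a <- monics Fq d) iota a ^+ m / iota a ^+ n.

Lemma psumE d n : psum d n = mixsum d 0 n.
Proof. by apply: eq_bigr => a _; rewrite expr0 mul1r. Qed.

Lemma mixsum_ge d m n : (n <= m)%N ->
  mixsum d m n = \sum_(a <- monics Fq d) iota a ^+ (m - n).
Proof.
move=> nm; apply: eq_big_seq => a /monics_neq0 a0.
by rewrite expfB_cond// iota_eq0 (negPf a0).
Qed.

Lemma mixsum_lt d m n : (m <= n)%N -> mixsum d m n = psum d (n - m).
Proof.
move=> mn; rewrite psumE; apply: eq_big_seq => a /monics_neq0 a0.
by rewrite expr0 mul1r -invf_div -expfB_cond// iota_eq0 (negPf a0).
Qed.

Lemma mixsum_eq0 d k n : (0 < n <= q ^ k)%N -> (q ^ k < q ^ d + n.-1)%N ->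
  mixsum d (q ^ k) n = 0.
Proof.
move=> /andP[n0 nk] kd; rewrite mixsum_ge// sum_monics_expr_eq0//.
by have := expq_gt0 Fq d; lia.
Qed.

Lemma mixsum_gt d k n : (0 < n)%N -> (n <= q ^ k)%N -> (k < d)%N ->
  mixsum d (q ^ k) n = 0.
Proof.
move=> n0 nk kd; apply: mixsum_eq0; first by rewrite n0.
by rewrite ltn_addr// ltn_expq.
Qed.

Lemma sum_carlitzE_monics d i n :
  \sum_(a <- monics Fq d) carlitzE i (iota a) / iota a ^+ n =
  \sum_(k < i.+1) ecoef k i * mixsum d (q ^ k) n.
Proof.
under [RHS]eq_bigr do rewrite mulr_sumr.
rewrite exchange_big; apply: eq_bigr => a _ /=.
by rewrite mulr_suml; apply: eq_bigr => k _; rewrite mulrA.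
Qed.

Lemma psum_carlitzE d n :
  psum d n = \sum_(k < d.+1) ecoef k d * mixsum d (q ^ k) n.
Proof.
rewrite -sum_carlitzE_monics psumE; apply: eq_big_seq => a a_mon.
by rewrite carlitzE_monic// expr0.
Qed.

(** Weighting the power sum by E_d, which is 1 on the monic polynomials of
    degree d, trades the exponent 1 for the exponents 1 - q^k, and all the sums
    with these exponents are known. *)
Lemma psum1 d : psum d 1 = (carlitzL d)^-1.
Proof.
rewrite psum_carlitzE big_ord_recr/= big1 ?add0r => [|k _]; last first.
  by rewrite mixsum_gt ?mulr0// expq_gt0.
rewrite mixsum_ge ?expq_gt0// subn1 sum_monics_expr_top.
rewrite /ecoef leqnn subnn carlitzL0 expr1n mulr1 mulKf//.
exact: carlitzD_neq0.
Qed.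

(** The exponents n - q^k with k > 0 that carlitzE introduces are in the range
    where the power sums vanish, so that only k = 0 remains. *)
Lemma psum_lt d n : (0 < n <= q)%N ->
  psum d n = (carlitzL d)^-1 ^+ n.
Proof.
case: n => // n; elim: n => [|n IHn] /=; first by rewrite psum1 expr1.
move=> nq; rewrite psum_carlitzE big_ord_recl/= big1 ?addr0 => [|k _]; last first.
  have [nk kd] : (n.+2 <= q ^ k.+1)%N /\ (q ^ k.+1 <= q ^ d)%N.
    by rewrite leq_expq (leq_trans nq)// expnS leq_pmulr// expq_gt0.
  by rewrite mixsum_eq0 ?mulr0// /bump add1n//= addnS ltnS (leq_trans kd)// leq_addr.
rewrite expn0 mixsum_lt// subn1 /= IHn; last exact: ltnW.
rewrite /ecoef /= carlitzD0 mul1r subn0 expn0 expr1.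
by rewrite -exprS.
Qed.

Lemma psum_frob d n k :
  psum d n ^+ (q ^ k) = psum d (n * q ^ k).
Proof.
rewrite !psumE (frobenius_sum constK); apply: eq_bigr => a _.
by rewrite !expr0 !mul1r exprVn exprM.
Qed.

End Carlitz.

(** * Products of power sums *)

Section PartialFractions.
Variable K : fieldType.

(** The coefficients do not depend on x and y, so that the identity can be summed
    over all pairs of distinct monic polynomials. *)
Lemma partial_fractions N m n : (m + n = N.+1)%N ->
  exists u v : nat -> K,
    ((0 < m)%N -> (0 < n)%N -> u 0%N = 0 /\ v 0%N = 0) /\
    forall x y, x != 0 -> y != 0 -> x != y ->
    x ^- m * y ^- n =
    \sum_(j < N.+1)
      (x - y) ^- j * (u j * x ^- (N.+1 - j) + v j * y ^- (N.+1 - j)).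
Proof.
elim: N m n => [|N IHN] m n.
  case: m n => [|[|m]] [|[|n]]// _.
    exists (fun=> 0), (fun=> 1); split=> // x y _ _ _.
    by rewrite big_ord1 !expr0 !expr1 invr1 !mul1r mul0r add0r.
  exists (fun=> 1), (fun=> 0); split=> // x y _ _ _.
  by rewrite big_ord1 !expr0 !expr1 invr1 !mul1r mul0r addr0 mulr1.
case: m => [|m]; last case: n => [|n].
- rewrite add0n => ->; exists (fun=> 0), (fun j => (j == 0)%:R); split=> // x y _ _ _.
  rewrite big_ord_recl big1/= => [|j _]; last by rewrite !mul0r addr0 mulr0.
  by rewrite !expr0 invr1 !mul1r mul0r add0r addr0.
- rewrite addn0 => ->; exists (fun j => (j == 0)%:R), (fun=> 0); split=> // x y _ _ _.
  rewrite big_ord_recl big1/= => [|j _]; last by rewrite !mul0r addr0 mulr0.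
  by rewrite !expr0 invr1 !mul1r mulr1 mul0r !addr0.
move=> mnN.
have /IHN[u1 [v1 [_ uv1]]] : (m + n.+1 = N.+1)%N by lia.
have /IHN[u2 [v2 [_ uv2]]] : (m.+1 + n = N.+1)%N by lia.
exists (fun j => if j is j'.+1 then u1 j' - u2 j' else 0),
  (fun j => if j is j'.+1 then v1 j' - v2 j' else 0); split=> // x y x0 y0 xy.
have xy0 : x - y != 0 by rewrite subr_eq0.
rewrite big_ord_recl/= !mul0r addr0 mulr0 add0r.
(* 1 / (x y) = (1 / (x - y)) (1 / y - 1 / x) lowers the total exponent *)
have -> : x ^- m.+1 * y ^- n.+1 =
    (x - y)^-1 * (x ^- m * y ^- n.+1 - x ^- m.+1 * y ^- n).
  by rewrite !exprS; field; rewrite ?x0 ?y0 ?xy0 ?expf_neq0.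
rewrite uv1// uv2// -sumrB mulr_sumr; apply: eq_bigr => j _.
rewrite /bump add1n subSS exprS invfM -mulrA; congr (_ * _).
by rewrite -mulrBr; congr (_ * _); ring.
Qed.

End PartialFractions.

Section Chen.
Variables (Fq : finFieldType) (K : fieldType) (iota : {rmorphism {poly Fq} -> K}).
Hypothesis iota_inj : injective iota.
Local Notation psum := (psum iota).

Definition nzpolys d : seq {poly Fq} :=
  [seq val b | b <- enum {poly_d Fq} & val b != 0].

Lemma mem_nzpolys d c : (c \in nzpolys d) = (c != 0) && (size c <= d)%N.
Proof.
apply/mapP/andP => [[b]|[c0 sc]].
  by rewrite mem_filter => /andP[b0 _] ->; rewrite size_npoly.
exists (npolyp d c); last by rewrite /= npolypK.
by rewrite mem_filter /= npolypK// c0 mem_enum.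
Qed.

Lemma uniq_nzpolys d : uniq (nzpolys d).
Proof. by rewrite (map_inj_uniq val_inj) filter_uniq// enum_uniq. Qed.

Lemma size_sub_monic d a b : a \in monics Fq d -> b \in monics Fq d ->
  (size (a - b)%R <= d)%N.
Proof.
rewrite !mem_monics => /andP[/monicP a1 /eqP sa] /andP[/monicP b1 /eqP sb].
apply/leq_sizeP => i; rewrite leq_eqVlt coefB => /predU1P[<-|di].
  rewrite -[X in a`_X]/(d.+1.-1) -[X in _ - b`_X]/(d.+1.-1) -{1}sa -sb.
  by rewrite -!lead_coefE a1 b1 subrr.
by rewrite !nth_default ?sa ?sb// subrr.
Qed.

Lemma perm_sub_monic d a : a \in monics Fq d ->
  perm_eq [seq a - b | b <- rem a (monics Fq d)] (nzpolys d).
Proof.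
move=> a_mon; apply: uniq_perm; rewrite ?uniq_nzpolys//.
  rewrite map_inj_uniq ?rem_uniq ?uniq_monics// => x y /addrI.
  exact: oppr_inj.
move=> c; rewrite mem_nzpolys; apply/mapP/andP => [[b]|[c0 sc]].
  rewrite mem_rem_uniq ?uniq_monics// => /andP[/= ba b_mon] ->.
  by rewrite subr_eq0 eq_sym ba size_sub_monic.
exists (a - c); last by rewrite subKr.
rewrite mem_rem_uniq ?uniq_monics// inE/= -subr_eq0 addrAC subrr add0r oppr_eq0 c0.
move: a_mon; rewrite !mem_monics => /andP[a_mon /eqP sa].
have sca : (size (- c)%R < size a)%N by rewrite size_polyN sa.
by rewrite monicE lead_coefDl// size_polyDl// sa eqxx andbT -monicE.
Qed.

Lemma perm_nzpolysS d :
  perm_eq (nzpolys d.+1)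
    (nzpolys d ++
     [seq u *: a | u <- [seq u <- index_enum Fq | u != 0], a <- monics Fq d]).
Proof.
apply: uniq_perm; rewrite ?uniq_nzpolys//.
  rewrite cat_uniq uniq_nzpolys /=; apply/andP; split.
    apply/hasPn => _ /allpairsP[[u a] [/= + + ->]].
    rewrite mem_filter => /andP[u0 _]; rewrite mem_monics => /andP[_ /eqP sa].
    by rewrite mem_nzpolys size_scale// sa ltnn andbF.
  apply: allpairs_uniq; rewrite ?uniq_monics ?filter_uniq ?index_enum_uniq//.
  move=> _ _ /allpairsP[[u a] [/= u0 a_mon ->]] /allpairsP[[v b] [/= v0 b_mon ->]] /=.
  move: u0 v0 a_mon b_mon; rewrite !mem_filter !mem_monics.
  move=> /andP[u0 _] /andP[v0 _] /andP[/monicP a1 _] /andP[/monicP b1 _] uavb.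
  have uv : u = v.
    by have := congr1 lead_coef uavb; rewrite !lead_coefZ a1 b1 !mulr1.
  by move: uavb; rewrite uv => /(scalerI v0) ->.
move=> c; rewrite mem_cat !mem_nzpolys; apply/idP/orP.
  move=> /andP[c0]; rewrite leq_eqVlt ltnS => /predU1P[sc|sc]; last first.
    by left; rewrite c0.
  right; apply/allpairsP; exists (lead_coef c, (lead_coef c)^-1 *: c) => /=.
  have lc0 : lead_coef c != 0 by rewrite lead_coef_eq0.
  rewrite mem_filter lc0 mem_index_enum mem_monics scalerA divff// scale1r; split=> //.
  by rewrite monicE lead_coefZ mulVf// eqxx size_scale ?invr_eq0// sc eqxx.
case=> [/andP[c0 sc]|/allpairsP[[u a] [/= + + ->]]]; first by rewrite c0 leqW.
rewrite mem_filter => /andP[u0 _]; rewrite mem_monics => /andP[a_mon /eqP sa].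
by rewrite scaler_eq0 negb_or u0 monic_neq0// size_scale// sa leqnn.
Qed.

Lemma sum_nzpolys d j :
  \sum_(c <- nzpolys d) iota c ^- j =
  (\sum_(u : Fq | u != 0) iota u%:P ^- j) * \sum_(e < d) psum e j.
Proof.
elim: d => [|d IHd].
  rewrite big_ord0 mulr0 big_seq big1// => c.
  by rewrite mem_nzpolys leqn0 size_poly_eq0 => /andP[/negPf->].
rewrite (perm_big _ (perm_nzpolysS d)) big_cat/= IHd big_ord_recr/= mulrDr.
congr (_ + _); rewrite big_allpairs_dep big_filter mulr_suml.
apply: eq_bigr => u _; rewrite mulr_sumr; apply: eq_bigr => a _.
by rewrite -mul_polyC rmorphM exprMn invfM.
Qed.

(** Chen's formula: in the product of the power sums the terms with a <> b are
    expanded in partial fractions, where a - b runs over the nonzero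
    polynomials of degree < d whatever a (or b) is. *)
Lemma psum_mul m n : (0 < m)%N -> (0 < n)%N -> exists f : nat -> K, forall d,
  psum d m * psum d n = psum d (m + n) +
  \sum_(1 <= j < m + n) f j * (psum d (m + n - j) * \sum_(e < d) psum e j).
Proof.
move=> m0 n0; have mn : (m + n = (m + n).-1.+1)%N by lia.
have [u [v [/(_ m0 n0)[u0 v0] uv]]] := partial_fractions K mn.
exists (fun j => (u j + v j) * \sum_(c : Fq | c != 0) iota c%:P ^- j) => d.
set s := monics Fq d; set N := (m + n)%N.
have diag h : \sum_(a <- s) \sum_(b <- s) h a b =
    \sum_(a <- s) h a a + \sum_(a <- s) \sum_(b <- rem a s) h a b :> K.
  rewrite -big_split; apply: eq_big_seq => a a_s /=.
  by rewrite (perm_big _ (perm_to_rem a_s)) big_cons.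
have swap h : \sum_(a <- s) \sum_(b <- rem a s) h a b =
    \sum_(b <- s) \sum_(a <- rem b s) h a b :> K.
  apply: (addrI (\sum_(a <- s) h a a)); rewrite -diag exchange_big.
  exact: (diag (fun b a => h a b)).
(* for fixed a, or fixed b, a - b runs over the nonzero polynomials of degree < d *)
have sub1 (j k : nat) : \sum_(a <- s) \sum_(b <- rem a s)
      (iota a - iota b) ^- j * iota a ^- k =
    psum d k * \sum_(c <- nzpolys d) iota c ^- j.
  rewrite mulr_suml; apply: eq_big_seq => a a_s.
  rewrite -(perm_big _ (perm_sub_monic a_s)) big_map mulr_sumr.
  by apply: eq_bigr => b _; rewrite rmorphB mulrC.
have sub2 (j k : nat) : \sum_(a <- s) \sum_(b <- rem a s)
      (iota a - iota b) ^- j * iota b ^- k =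
    psum d k * \sum_(c <- nzpolys d) iota c ^- j.
  rewrite swap mulr_suml; apply: eq_big_seq => b b_s; rewrite mulr_sumr.
  have pN : perm_eq [seq a - b | a <- rem b s] (nzpolys d).
    apply: uniq_perm; rewrite ?uniq_nzpolys//.
      by rewrite map_inj_uniq ?rem_uniq ?uniq_monics//; apply: addIr.
    move=> c; rewrite mem_nzpolys -oppr_eq0 -size_polyN -mem_nzpolys.
    rewrite -(perm_mem (perm_sub_monic b_s)).
    have -> : [seq b - b0 | b0 <- rem b s] = [seq - (a - b) | a <- rem b s].
      by apply: eq_map => a; rewrite opprB.
    by rewrite map_comp mem_map//; apply: oppr_inj.
  by rewrite -(perm_big _ pN) big_map; apply: eq_bigr => a _; rewrite rmorphB mulrC.
rewrite {1 2}/psum mulr_suml; under eq_bigr do rewrite mulr_sumr.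
rewrite diag; congr (_ + _).
  by apply: eq_bigr => a _; rewrite exprD invfM.
have -> : \sum_(a <- s) \sum_(b <- rem a s) iota a ^- m * iota b ^- n =
    \sum_(0 <= j < N) (\sum_(a <- s) \sum_(b <- rem a s)
        (iota a - iota b) ^- j * iota a ^- (N - j) * u j
      + \sum_(a <- s) \sum_(b <- rem a s)
        (iota a - iota b) ^- j * iota b ^- (N - j) * v j).
  rewrite big_mkord; under [RHS]eq_bigr do rewrite -big_split/=.
  rewrite exchange_big; apply: eq_big_seq => a a_s.
  under [RHS]eq_bigr do rewrite -big_split/=.
  rewrite exchange_big; apply: eq_big_seq => b.
  rewrite mem_rem_uniq ?uniq_monics// => /andP[/= ba b_s].
  rewrite uv ?iota_eq0// ?(monics_neq0 a_s) ?(monics_neq0 b_s)//.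
    rewrite -mn; apply: eq_bigr => j _; rewrite -/N; ring.
  by rewrite (inj_eq iota_inj) eq_sym.
(* j = 0 does not occur in the partial fractions, m and n being positive *)
rewrite big_ltn ?addn_gt0 ?m0//.
rewrite u0 v0 big1 ?add0r => [|a _]; last first.
  by rewrite big1// => b _; rewrite mulr0.
rewrite big1 ?add0r => [|a _]; last by rewrite big1// => b _; rewrite mulr0.
apply: eq_bigr => j _.
under eq_bigr do rewrite -mulr_suml.
under [X in _ + X]eq_bigr do rewrite -mulr_suml.
rewrite -!mulr_suml sub1 sub2 sum_nzpolys; ring.
Qed.

End Chen.

(** * Nested sums and their products *)

Section Nest.
Variables (X : Type) (P : comNzRingType) (phi : X -> nat -> P).

(** The sum of phi a_1 d_1 * ... * phi a_r d_r over N > d_1 > ... > d_r, for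
    w = [:: a_1; ...; a_r]. *)
Fixpoint nest (w : seq X) (N : nat) : P :=
  if w is a :: u then \sum_(d < N) phi a d * nest u d else 1.

Lemma nest_cons a u N : nest (a :: u) N = \sum_(d < N) phi a d * nest u d.
Proof. by []. Qed.

Lemma nest_seq1 a N : nest [:: a] N = \sum_(d < N) phi a d.
Proof. by apply: eq_bigr => d _; rewrite mulr1. Qed.

Lemma nestS a u N : nest (a :: u) N.+1 = nest (a :: u) N + phi a N * nest u N.
Proof. by rewrite /= big_ord_recr. Qed.

(** The largest degree belongs to the first word, to the second, or to both. *)
Lemma nest_mul a u b v N :
  nest (a :: u) N * nest (b :: v) N =
  \sum_(d < N) phi a d * (nest u d * nest (b :: v) d)
  + \sum_(d < N) phi b d * (nest (a :: u) d * nest v d)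
  + \sum_(d < N) phi a d * phi b d * (nest u d * nest v d).
Proof.
elim: N => [|N IHN]; first by rewrite !nest_cons !big_ord0 mul0r !addr0.
rewrite !nestS mulrDl !mulrDr IHN !big_ord_recr/=; ring.
Qed.

End Nest.

Lemma nest_rmorph (X : Type) (P P' : comNzRingType) (g : {rmorphism P -> P'})
  (phi : X -> nat -> P) w N :
  g (nest phi w N) = nest (fun a d => g (phi a d)) w N.
Proof.
elim: w N => [|a u IHu] N /=; first exact: rmorph1.
by rewrite rmorph_sum; apply: eq_bigr => d _; rewrite rmorphM IHu.
Qed.

Lemma eq_nest (X : eqType) (P : comNzRingType) (phi psi : X -> nat -> P) w N :
  {in w, forall a d, (d < N)%N -> phi a d = psi a d} ->
  nest phi w N = nest psi w N.
Proof.
elim: w N => [//|a u IHu] N H /=; apply: eq_bigr => d _.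
rewrite H ?mem_head// IHu// => b b_u e ed.
by rewrite H ?(ltn_trans ed)// inE b_u orbT.
Qed.

Definition mkposn n : posn := exist _ n.-1.+1 isT.

Lemma posn_gt0 (n : posn) : (0 < n)%N.
Proof. exact: valP. Qed.

Lemma mkposnE n : (0 < n)%N -> mkposn n = n :> nat.
Proof. exact: prednK. Qed.

(** The array c is admissible for (ty c, wt c) only. *)
Definition ty (c : array) : {cmonom posn} := \big[mmul/mone]_(a <- c) a.1.
Definition wt (c : array) : nat := (\sum_(a <- c) a.2)%N.

Section Span.
Variables (K : fieldType) (P : comAlgType K).
Local Notation col := ({cmonom posn} * posn)%type.
Variable phi : col -> nat -> P.

(** The sequences, indexed by the truncation N, that are a combination of nested
    sums with coefficients which do not depend on N. *)
Definition Nspan (Q : array -> Prop) (g : nat -> P) := exists s : seq (K * array),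
  {in s, forall bc, Q bc.2} /\
  forall N, g N = \sum_(bc <- s) bc.1 *: nest phi bc.2 N.

Lemma nspan_ext Q g h : g =1 h -> Nspan Q g -> Nspan Q h.
Proof. by move=> gh [s [sQ sE]]; exists s; split=> // N; rewrite -gh. Qed.

Lemma nspan_sub (Q Q' : array -> Prop) g : (forall c, Q c -> Q' c) ->
  Nspan Q g -> Nspan Q' g.
Proof. by move=> QQ' [s [sQ sE]]; exists s; split=> // bc /sQ /QQ'. Qed.

Lemma nspan_nest (Q : array -> Prop) c : Q c -> Nspan Q (nest phi c).
Proof.
move=> Qc; exists [:: (1, c)]; split=> [bc|N]; first by rewrite inE => /eqP->.
by rewrite big_seq1 scale1r.
Qed.

Lemma nspan0 Q : Nspan Q (fun=> 0).
Proof. by exists [::]; split=> // N; rewrite big_nil. Qed.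

Lemma nspanD Q g h : Nspan Q g -> Nspan Q h -> Nspan Q (fun N => g N + h N).
Proof.
move=> [s [sQ sE]] [t [tQ tE]]; exists (s ++ t); split=> [bc|N].
  by rewrite mem_cat => /orP[/sQ|/tQ].
by rewrite big_cat sE tE.
Qed.

Lemma nspanZ Q b g : Nspan Q g -> Nspan Q (fun N => b *: g N).
Proof.
move=> [s [sQ sE]]; exists [seq (b * bc.1, bc.2) | bc <- s]; split=> [bc|N].
  by move=> /mapP[bc' /sQ ? ->].
by rewrite big_map sE scaler_sumr; apply: eq_bigr => bc _; rewrite scalerA.
Qed.

Lemma nspan_sum Q (I : eqType) (r : seq I) (g : I -> nat -> P) :
  {in r, forall i, Nspan Q (g i)} -> Nspan Q (fun N => \sum_(i <- r) g i N).
Proof.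
elim: r => [|i r IHr] gQ.
  by apply: nspan_ext (nspan0 Q) => N; rewrite big_nil.
apply: (@nspan_ext _ (fun N => g i N + \sum_(j <- r) g j N)).
  by move=> N; rewrite big_cons.
apply: nspanD; first by apply: gQ; rewrite mem_head.
by apply: IHr => j jr; apply: gQ; rewrite inE jr orbT.
Qed.

Lemma nspan_cons (Q Q' : array -> Prop) a g :
  (forall c, Q c -> Q' (a :: c)) -> Nspan Q g ->
  Nspan Q' (fun N => \sum_(d < N) phi a d * g d).
Proof.
move=> QQ' [s [sQ sE]]; exists [seq (bc.1, a :: bc.2) | bc <- s]; split=> [bc|N].
  by move=> /mapP[bc' /sQ /QQ' ? ->].
rewrite big_map; under [RHS]eq_bigr do rewrite nest_cons scaler_sumr.
rewrite exchange_big; apply: eq_bigr => d _ /=.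
by rewrite sE mulr_sumr; apply: eq_bigr => bc _; rewrite scalerAr.
Qed.

Lemma nspan_mul (Q Q' Q'' : array -> Prop) g h :
  (forall c c', Q c -> Q' c' -> Nspan Q'' (fun N => nest phi c N * nest phi c' N)) ->
  Nspan Q g -> Nspan Q' h -> Nspan Q'' (fun N => g N * h N).
Proof.
move=> QQ' [s [sQ sE]] [t [tQ tE]].
apply: (@nspan_ext _ (fun N => \sum_(b <- s) \sum_(c <- t)
    (b.1 * c.1) *: (nest phi b.2 N * nest phi c.2 N))).
  move=> N; rewrite sE tE mulr_suml; apply: eq_bigr => b _.
  rewrite mulr_sumr; apply: eq_bigr => c _.
  by rewrite -scalerAl -scalerAr scalerA.
apply: nspan_sum => b b_s; apply: nspan_sum => c c_t.
by apply/nspanZ/QQ'; [apply: sQ|apply: tQ].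
Qed.

(** What Chen's formula says about the letters of lambda_A. *)
Hypothesis phi_mul : forall (s t : {cmonom posn}) (m n : posn),
  exists f : nat -> K, forall d,
  phi (s, m) d * phi (t, n) d = phi (mmul s t, mkposn (m + n)) d +
  \sum_(1 <= j < m + n) f j *: (phi (mmul s t, mkposn (m + n - j)) d *
    nest phi [:: (mone, mkposn j)] d).

(** The nested sums multiply like quasi-symmetric functions, except that two
    terms of equal degree are merged by Chen's formula, of which the correction
    terms have an additional nested sum; the total weight of the remaining
    arrays decreases in all cases. *)
Lemma nspan_nest_mul c c' :
  Nspan (admissible (mmul (ty c) (ty c')) (wt c + wt c'))
    (fun N => nest phi c N * nest phi c' N).
Proof.
have [W] := ubnP (wt c + wt c'); elim: W c c' => // W IHW.
case=> [|[s m] u] c' cW.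
  apply: (@nspan_ext _ (nest phi c')); first by move=> N; rewrite mul1r.
  by apply: nspan_nest; rewrite /ty /wt !big_nil mul1m add0n.
case: c' cW => [|[t n] v] cW.
  apply: (@nspan_ext _ (nest phi ((s, m) :: u))); first by move=> N; rewrite mulr1.
  by apply: nspan_nest; rewrite /ty /wt !big_nil mulm1 addn0.
have [f fE] := phi_mul s t m n.
apply: nspan_ext => [N|]; first by rewrite nest_mul.
have m0 := posn_gt0 m; have n0 := posn_gt0 n.
have wtE a w : wt (a :: w) = (a.2 + wt w)%N by rewrite /wt big_cons.
have tyE a w : ty (a :: w) = mmul a.1 (ty w) by rewrite /ty big_cons.
rewrite !wtE /= in cW *.
have mCA (x y z : {cmonom posn}) : mmul x (mmul y z) = mmul y (mmul x z).
  by rewrite !mulmA (mulmC x).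
have cons_adm (a : col) x k y l w : mmul a.1 x = y -> (a.2 + k = l)%N ->
    admissible x k w -> admissible y l (a :: w).
  by move=> <- <- [<- <-]; rewrite /admissible !big_cons.
apply: nspanD; first apply: nspanD.
- apply: nspan_cons (IHW u ((t, n) :: v) _) => [w|]; last by rewrite wtE/=; lia.
  by apply: cons_adm; rewrite ?tyE ?wtE/= ?mulmA//; lia.
- apply: nspan_cons (IHW ((s, m) :: u) v _) => [w|]; last by rewrite wtE/=; lia.
  apply: cons_adm; rewrite ?tyE ?wtE/=; last by lia.
  exact: mCA.
have uvS : Nspan (admissible (mmul (ty u) (ty v)) (wt u + wt v))
    (fun N => nest phi u N * nest phi v N) by apply: IHW; lia.
have mE : mmul (mmul s t) (mmul (ty u) (ty v)) = mmul (mmul s (ty u)) (mmul t (ty v)).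
  by rewrite -!mulmA; congr (mmul _ _); exact: mCA.
apply: (@nspan_ext _ (fun N =>
    \sum_(d < N) phi (mmul s t, mkposn (m + n)) d * (nest phi u d * nest phi v d)
  + \sum_(j <- index_iota 1 (m + n)) f j *:
      \sum_(d < N) phi (mmul s t, mkposn (m + n - j)) d *
        (nest phi [:: (mone, mkposn j)] d * (nest phi u d * nest phi v d)))).
  move=> N; under [X in _ + X]eq_bigr do rewrite scaler_sumr.
  rewrite exchange_big -big_split; apply: eq_bigr => d _.
  rewrite fE mulrDl mulr_suml; congr (_ + _); apply: eq_bigr => j _.
  by rewrite -scalerAl -mulrA.
apply: nspanD.
  apply: nspan_cons uvS => w; apply: cons_adm; rewrite ?tyE//=.
  by rewrite mkposnE ?addn_gt0 ?m0//; lia.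
apply: nspan_sum => j; rewrite mem_index_iota => /andP[j1 jmn]; apply: nspanZ.
have juvS : Nspan (admissible (mmul (ty u) (ty v)) (j + (wt u + wt v)))
    (fun N => nest phi [:: (mone, mkposn j)] N * (nest phi u N * nest phi v N)).
  apply: nspan_mul (nspan_nest (erefl [:: (mone, mkposn j)])) uvS.
  move=> _ w <- [wty wwt]; have := IHW [:: (mone, mkposn j)] w.
  have -> : ty [:: (mone, mkposn j)] = mone by rewrite /ty big_seq1.
  have -> : wt [:: (mone, mkposn j)] = j by rewrite /wt big_seq1 mkposnE.
  rewrite -[ty w]/(\big[mmul/mone]_(col <- w) col.1) wty mul1m.
  rewrite -[wt w]/(\sum_(col <- w) col.2)%N wwt; apply; lia.
apply: nspan_cons juvS => w.
by apply: cons_adm; rewrite ?tyE//= mkposnE ?subn_gt0//; lia.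
Qed.

End Span.

Section Letters.
Variables (Fq : finFieldType) (K : fieldType) (iota : {rmorphism {poly Fq} -> K}).
Hypothesis iota_inj : injective iota.
Local Notation psum := (psum iota).
Local Notation q := #|Fq|.
Local Notation P := {malg K[{cmonom posn}]}.
Local Notation col := ({cmonom posn} * posn)%type.

Lemma expcmnE (m : {cmonom posn}) n i : expcmn m n i = (m i * n)%N.
Proof.
rewrite /expcmn; case: n => [|n]; first by rewrite onecmE muln0.
rewrite iteropS; elim: n => [|n IHn]; first by rewrite muln1.
by rewrite iterS mulcmE IHn -mulnS.
Qed.

Lemma expcmnM (m m' : {cmonom posn}) n :
  expcmn (mmul m m') n = mmul (expcmn m n) (expcmn m' n).
Proof. by apply/eqP/cmP => i; rewrite cmM !expcmnE cmM mulnDl. Qed.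

Lemma expcmn1 n : expcmn mone n = mone :> {cmonom posn}.
Proof. by apply/eqP/cmP => i; rewrite expcmnE cm1. Qed.

(** The letters of lambda_A: nest lam c N is lambda_A(c) truncated to degrees < N. *)
Definition lam (a : col) d : P := << psum d a.2 *g expcmn a.1 (q ^ d) >>.

Lemma lamE a d : lam a d = << psum d a.2 *g expcmn a.1 (q ^ d) >>.
Proof. by []. Qed.

Lemma monalgM (b b' : K) (x x' : {cmonom posn}) :
  << b *g x >> * << b' *g x' >> = << (b * b') *g mmul x x' >> :> P.
Proof. by rewrite malgM_def fgmulUU. Qed.

Lemma expcmnS (x : {cmonom posn}) m : expcmn x m.+1 = mmul x (expcmn x m).
Proof. by apply/eqP/cmP => i; rewrite cmM !expcmnE mulnS. Qed.

Lemma monalgX (b : K) (x : {cmonom posn}) m :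
  << b *g x >> ^+ m = << b ^+ m *g expcmn x m >> :> P.
Proof.
elim: m => [//|m IHm]; rewrite [LHS]exprS IHm [b ^+ m.+1]exprS expcmnS.
exact: monalgM.
Qed.

Lemma monalgZ (b b' : K) (x : {cmonom posn}) :
  b *: << b' *g x >> = << (b * b') *g x >> :> P.
Proof.
by apply/malgP => k; rewrite [LHS]mcoeffZ [in LHS]mcoeffU mcoeffU mulrnAr.
Qed.

Lemma lamM a b d :
  lam a d * lam b d =
  << (psum d a.2 * psum d b.2) *g expcmn (mmul a.1 b.1) (q ^ d) >>.
Proof. by rewrite expcmnM; exact: monalgM. Qed.

(** Chen's formula for letters; the correction terms are nested sums since the
    sum of S_e(j) over e < d is a truncated zeta value. *)
Lemma lam_mul (s t : {cmonom posn}) (m n : posn) : exists f : nat -> K, forall d,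
  lam (s, m) d * lam (t, n) d = lam (mmul s t, mkposn (m + n)) d +
  \sum_(1 <= j < m + n) f j *: (lam (mmul s t, mkposn (m + n - j)) d *
    nest lam [:: (mone, mkposn j)] d).
Proof.
have [f fE] := psum_mul iota_inj (posn_gt0 m) (posn_gt0 n); exists f => d.
have lamU a j : lam a d * nest lam [:: (mone, mkposn j)] d =
    << (psum d a.2 * \sum_(e < d) psum e (mkposn j)) *g expcmn a.1 (q ^ d) >>.
  rewrite lamE nest_cons (eq_bigr (fun e : 'I_d => << psum e (mkposn j) *g mone >>)).
    by rewrite -raddf_sum monalgM mulm1.
  by move=> e _; rewrite mulr1 lamE expcmn1.
rewrite [LHS]lamM fE monalgUD !lamE mkposnE ?addn_gt0 ?posn_gt0//.
congr (_ + _); rewrite raddf_sum big_nat [in RHS]big_nat.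
apply: eq_bigr => j /andP[j1 jmn]; rewrite lamU !mkposnE ?subn_gt0//.
by rewrite [RHS]monalgZ.
Qed.

Lemma expcmn_mul (s : {cmonom posn}) a b :
  expcmn (expcmn s a) b = expcmn s (a * b).
Proof. by apply/eqP/cmP => i; rewrite !expcmnE mulnA. Qed.

(** Since the characteristic divides q, a q^k-th power only retains the
    q^k-th powers of the terms. *)
Lemma nest_seq1_frob (s : {cmonom posn}) k N :
  nest lam [:: (s, mkposn 1)] N ^+ (q ^ k) =
  nest lam [:: (expcmn s (q ^ k), mkposn (q ^ k))] N.
Proof.
rewrite !nest_seq1 (frobenius_sum (@malgC _ K \o constK iota)).
apply: eq_bigr => d _; rewrite !lamE [LHS]monalgX !expcmn_mul mulnC psum_frob.
by rewrite mul1n mkposnE ?expq_gt0.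
Qed.

End Letters.

(** * The coefficients of E_i as nested sums *)

Section CarlitzNest.
Variables (Fq : finFieldType) (K : fieldType) (iota : {rmorphism {poly Fq} -> K}).
Hypothesis iota_inj : injective iota.
Local Notation psum := (psum iota).
Local Notation mixsum := (mixsum iota).
Local Notation ecoef := (ecoef iota).
Local Notation carlitzL := (carlitzL iota).
Local Notation lam := (lam iota).
Local Notation q := #|Fq|.
Local Notation P := {malg K[{cmonom posn}]}.
Local Notation col := ({cmonom posn} * posn)%type.

Lemma predq_gt0 : (0 < q.-1)%N.
Proof. by rewrite -ltnS prednK ?card_gt1// ltnW// card_gt1. Qed.

Definition psumcol (a : col) d : K := psum d a.2.

(** The effect of the q-th power on a letter of trivial type. *)
Definition frobcol (a : col) : col := (a.1, mkposn (a.2 * q)).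

(** The weights are q - 1, q (q - 1), ..., q^(k-1) (q - 1). *)
Fixpoint carlitz_word k : array :=
  if k is k'.+1 then
    (mone, mkposn q.-1) :: map frobcol (carlitz_word k')
  else [::].

Lemma ty_cons (a : col) w : ty (a :: w) = mmul a.1 (ty w).
Proof. by rewrite /ty big_cons. Qed.

Lemma wt_cons (a : col) w : wt (a :: w) = (a.2 + wt w)%N.
Proof. by rewrite /wt big_cons. Qed.

Lemma ty_carlitz_word k : ty (carlitz_word k) = mone.
Proof.
elim: k => [|k IHk]; first by rewrite /ty big_nil.
by rewrite ty_cons mul1m -[RHS]IHk /ty big_map.
Qed.

Lemma wt_carlitz_word k : (wt (carlitz_word k)).+1 = (q ^ k)%N.
Proof.
elim: k => [|k IHk]; first by rewrite /wt big_nil.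
have q1 := card_gt1 Fq; rewrite wt_cons expnS -IHk /= mkposnE; last exact: predq_gt0.
suff -> : wt (map frobcol (carlitz_word k)) =
  (q * wt (carlitz_word k))%N by rewrite mulnS -addSn prednK// ltnW.
rewrite /wt big_map big_distrr/=; apply: eq_bigr => a _.
by rewrite mkposnE ?muln_gt0 ?posn_gt0 ?(ltnW q1)// mulnC.
Qed.

Lemma nest_frob w N :
  nest psumcol (map frobcol w) N = nest psumcol w N ^+ q.
Proof.
elim: w N => [|a w IHw] N; first by rewrite /= expr1n.
rewrite map_cons !nest_cons -[q in RHS]expn1 (frobenius_sum (constK iota)).
apply: eq_bigr => d _; rewrite expn1 IHw exprMn; congr (_ * _).
rewrite /psumcol/= mkposnE ?muln_gt0 ?posn_gt0 ?(ltnW (card_gt1 Fq))//.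
by rewrite -[X in (_ * X)%N]expn1 -psum_frob expn1.
Qed.

(** Induction on i, the step being
    ecoef k.+1 i.+1 * L_(i+1) = ecoef k.+1 i * L_i - L_i * (ecoef k i) ^+ q,
    that is, e_(i+1) = e_i ^+ q - D_i ^+ (q-1) e_i after division by the linear
    coefficient. *)
Lemma ecoef_nest k i :
  ecoef k i = psum i 1 * (-1) ^+ k * nest psumcol (carlitz_word k) i.
Proof.
have q1 := card_gt1 Fq.
suff ecL : ecoef k i * carlitzL i = (-1) ^+ k * nest psumcol (carlitz_word k) i.
  by rewrite (psum1 iota_inj) -mulrA -ecL mulrC mulfK// carlitzL_neq0.
elim: i k => [|i IHi] [|k].
- by rewrite /ecoef /= carlitzD0 subnn carlitzL0 expn0 expr1 !mulr1 invr1.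
- by rewrite ecoef_out// mul0r /= big_ord0 mulr0.
- by rewrite /ecoef /= carlitzD0 mul1r expn0 expr1 mulVf ?mul1r// carlitzL_neq0.
have -> : ecoef k.+1 i.+1 * carlitzL i.+1 =
    ecoef k.+1 i * carlitzL i - carlitzL i * ecoef k i ^+ q.
  by rewrite carlitzLS -ecoef_frob// (ecoef_step iota_inj k.+1 i); ring.
have Li0 : carlitzL i != 0 by exact: carlitzL_neq0.
have -> : carlitzL i * ecoef k i ^+ q = psum i q.-1 * (ecoef k i * carlitzL i) ^+ q.
  rewrite psum_lt//; last by rewrite predq_gt0 leq_pred.
  have -> : (ecoef k i * carlitzL i) ^+ q =
      ecoef k i ^+ q * (carlitzL i * carlitzL i ^+ q.-1).
    by rewrite exprMn -exprS prednK// ltnW.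
  have := expf_neq0 q.-1 Li0; rewrite exprVn.
  by move: (_ ^+ q.-1) (_ ^+ q) => y z y0; field.
rewrite !IHi /carlitz_word -/carlitz_word nestS nest_frob exprMn.
have -> : ((-1) ^+ k) ^+ q = (-1) ^+ k :> K.
  have := frobN iota 1%N 1; rewrite expn1 expr1n => m1q.
  by rewrite exprAC m1q.
have -> : psumcol (mone, mkposn q.-1) i = psum i q.-1.
  by rewrite /psumcol mkposnE ?predq_gt0.
by rewrite exprS; ring.
Qed.

(** The left-hand side is the sum of E_i(a) / a^m over the monic polynomials a of
    degree d.  If d > i, the terms with q^k >= m are sums of nonnegative powers
    that vanish. *)
Lemma sum_ecoef_mixsum d i m : (0 < m)%N ->
  \sum_(k < i.+1) ecoef k i * mixsum d (q ^ k) m =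
  psum d m *+ (d == i) +
  (\sum_(k < m | (q ^ k < m)%N) ecoef k i * psum d (m - q ^ k)) *+ (i < d)%N.
Proof.
move=> m0; case: (ltngtP d i) => [di|id|->].
- rewrite -sum_carlitzE_monics big_seq big1 ?addr0// => a.
  by rewrite mem_monics => /andP[_ /eqP sa]; rewrite carlitzE_small ?mul0r ?sa.
- rewrite add0r mulr1n.
  rewrite (bigID (fun k : 'I__ => (q ^ k < m)%N)) /= [X in _ + X]big1 ?addr0.
    pose F k := ecoef k i * psum d (m - q ^ k).
    (* the coefficient vanishes for k > i, and q^k < m implies k < m *)
    have E1 n : (i < n)%N -> \sum_(k < i.+1 | (q ^ k < m)%N) F k =
        \sum_(k < n | (q ^ k < m)%N) F k.
      move=> ni; rewrite (big_ord_widen_cond n (fun k => q ^ k < m)%N F)//.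
      rewrite [RHS](bigID (fun k : 'I_n => (k < i.+1)%N)) /= [X in _ + X]big1 ?addr0//.
      by move=> k /andP[_]; rewrite -ltnNge => ik; rewrite /F ecoef_out ?mul0r.
    have E2 n : (m <= n)%N -> \sum_(k < m | (q ^ k < m)%N) F k =
        \sum_(k < n | (q ^ k < m)%N) F k.
      move=> mn; rewrite (big_ord_widen_cond n (fun k => q ^ k < m)%N F)//.
      apply: eq_bigl => k; case: ltnP => //= qkm.
      by rewrite (ltn_trans _ qkm)// ltn_expl// card_gt1.
    rewrite (E2 (i.+1 + m)%N) ?leq_addl// -(E1 (i.+1 + m)%N) ?leq_addr//.
    by apply: eq_bigr => k qkm; rewrite mixsum_lt ?(ltnW qkm).
  move=> k; rewrite -leqNgt => mqk.
  by rewrite (mixsum_gt iota_inj) ?mulr0// (leq_trans (ltn_ord k)).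
- rewrite mulr1n addr0 -sum_carlitzE_monics psumE; apply: eq_big_seq => a a_mon.
  by rewrite carlitzE_monic// expr0.
Qed.

Lemma ty_mone w (a : col) : ty w = mone -> a \in w -> a.1 = mone.
Proof.
elim: w => // b w IHw; rewrite ty_cons => /mulcm_eq0[b1 /IHw{}IHw].
by rewrite inE => /predU1P[->|//].
Qed.

Lemma nest_lam_mone w N : ty w = mone ->
  nest lam w N = (nest psumcol w N)%:MP.
Proof.
move=> w1; rewrite (nest_rmorph (@malgC _ K)); apply: eq_nest => a a_w d _.
by rewrite lamE (ty_mone w1 a_w) expcmn1.
Qed.

Lemma mmul_ucm (j : posn) (x y : {cmonom posn}) : mmul x y = ucm j ->
  x = mone /\ y = ucm j \/ x = ucm j /\ y = mone.
Proof.
move=> xy; have xyE i : (x i + y i)%N = (j == i) :> nat by rewrite -cmM xy ucmE.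
have := xyE j; rewrite eqxx; case xj : (x j) => [|[|//]]; [left|right].
  have x1 : x = mone.
    by apply/eqP/cmP => i; rewrite cm1; have := xyE i; case: eqP => [<-|]; lia.
  by rewrite x1 in xy *; rewrite -xy mul1m.
have y1 : y = mone.
  by apply/eqP/cmP => i; rewrite cm1; have := xyE i; case: eqP => [<-|]; lia.
by rewrite y1 in xy *; rewrite -xy mulm1.
Qed.

Lemma expcmn_ucm_inj (j : posn) : injective (expcmn (ucm j)).
Proof.
move=> a b ab; have : expcmn (ucm j) a j = expcmn (ucm j) b j by rewrite ab.
by rewrite !expcmnE ucmE eqxx !mul1n.
Qed.

Section OneVariable.
Variable j : posn.
Local Notation Xq i := (expcmn (ucm j) (q ^ i)).

(** The letter of zeta_A at the point t_j = theta^(q^k). *)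
Definition zetacol k (a : col) d : K := mixsum d (q ^ k * a.1 j) a.2.

Lemma mcoeff_lam m d i : (lam (ucm j, m) d)@_(Xq i) = psum d m *+ (d == i).
Proof.
rewrite lamE mcoeffU (inj_eq (@expcmn_ucm_inj j)) eqn_exp2l ?card_gt1//.
Qed.

Lemma mcoeffMC (x : P) (c : K) k : (x * c%:MP)@_k = x@_k * c.
Proof. by rewrite mulrC mcoeffCM mulrC. Qed.

Lemma mcoeff_nest_out c N nu : ty c = ucm j -> (forall i, nu != Xq i) ->
  (nest lam c N)@_nu = 0.
Proof.
move=> + nuX; elim: c N => [|[s m] c IHc] N.
  rewrite /ty big_nil => /(congr1 (fun x : {cmonom posn} => x j)).
  by rewrite cm1 ucmE eqxx.
rewrite ty_cons => /mmul_ucm[[/= -> c_ty]|[/= -> c_ty]];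
  rewrite raddf_sum big1// => d _ /=.
  by rewrite lamE expcmn1 mcoeffCM IHc// mulr0.
rewrite (nest_lam_mone _ c_ty) mcoeffMC lamE mcoeffU eq_sym.
by rewrite (negPf (nuX d)) mul0r.
Qed.

Lemma nest_zetacol_mone k w N : ty w = mone ->
  nest (zetacol k) w N = nest psumcol w N.
Proof.
move=> w1; apply: eq_nest => a a_w d _.
by rewrite /zetacol (ty_mone w1 a_w) cm1 muln0 -psumE.
Qed.

(** The coefficient of X_j^(q^i) forces the leading degree to be i, and
    ecoef_nest recognizes the rest. *)
Lemma mcoeff_carlitz_word k d i :
  (nest lam ((ucm j, mkposn 1) :: carlitz_word k) d)@_(Xq i) =
  ((-1) ^+ k * ecoef k i) *+ (i < d)%N.
Proof.
rewrite nest_cons raddf_sum /=.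
under eq_bigr => e _ do
  rewrite nest_lam_mone ?ty_carlitz_word// mcoeffMC mcoeff_lam mkposnE//.
case: ltnP => [id|di]; last first.
  by rewrite big1// => e _; rewrite ltn_eqF ?mulr0n ?mul0r// (leq_trans _ di).
rewrite (bigD1 (Ordinal id))//= eqxx !mulr1n big1 ?addr0 => [|e]; last first.
  by rewrite -val_eqE /= => /negPf->; rewrite mul0r.
by rewrite ecoef_nest -[LHS]mul1r -[X in X * _ = _](sqrr_sign K k) expr2; ring.
Qed.

(** If the leading letter has trivial type it is carried along; otherwise
    sum_ecoef_mixsum replaces it, and the factor ecoef k i, which is the
    coefficient of a nested sum of type {j}, is multiplied with the remaining
    letters. *)
Lemma F_zeta_span c n : admissible (ucm j) n c ->
  exists g : nat -> P, Nspan lam (admissible (ucm j) n) g /\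
  forall N i, \sum_(k < i.+1) ecoef k i * nest (zetacol k) c N = (g N)@_(Xq i).
Proof.
elim: c n => [|[s m] c IHc] n [].
  by rewrite big_nil => /(congr1 (fun x : {cmonom posn} => x j)); rewrite cm1 ucmE eqxx.
rewrite !big_cons => /mmul_ucm[[/= -> c_ty]|[/= -> c_ty]] c_wt.
  have [g [gS gE]] := IHc _ (conj c_ty erefl).
  exists (fun N => \sum_(d < N) lam (mone, m) d * g d); split=> [|N i].
    apply: nspan_cons gS => w [w_ty w_wt]; rewrite /admissible !big_cons /=.
    by rewrite mul1m w_wt.
  rewrite raddf_sum; under eq_bigr do rewrite mulr_sumr.
  rewrite exchange_big; apply: eq_bigr => d _ /=.
  rewrite lamE expcmn1 mcoeffCM -gE mulr_sumr; apply: eq_bigr => k _.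
  by rewrite {1}/zetacol /= cm1 muln0 -psumE mulrCA.
pose ks := [seq k <- seq.iota 0 m | (q ^ k < m)%N].
pose h k d := nest lam ((ucm j, mkposn 1) :: carlitz_word k) d * nest lam c d.
(* the first sum gives the terms with d = i of sum_ecoef_mixsum, and the second
   one those with d > i *)
exists (fun N => \sum_(d < N) lam (ucm j, m) d * nest lam c d +
  \sum_(k <- ks) (-1) ^+ k *:
    \sum_(d < N) lam (mone, mkposn (m - q ^ k)) d * h k d); split=> [|N i].
  apply: nspanD.
    have cS : Nspan lam (admissible mone (wt c)) (nest lam c).
      exact: nspan_nest (conj c_ty erefl).
    apply: nspan_cons cS => w [w_ty w_wt].
    by rewrite /admissible !big_cons /= w_ty w_wt mulm1.
  apply: nspan_sum => k; rewrite mem_filter => /andP[qkm _]; apply: nspanZ.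
  have := nspan_nest_mul (lam_mul iota_inj)
    ((ucm j, mkposn 1) :: carlitz_word k) c.
  rewrite ty_cons ty_carlitz_word wt_cons mkposnE// add1n wt_carlitz_word.
  rewrite mulm1 [ty c]c_ty mulm1 => /nspan_cons; apply=> w [w_ty w_wt].
  rewrite /admissible !big_cons /= w_ty w_wt mul1m mkposnE ?subn_gt0//.
  by rewrite addnA subnK// ltnW.
pose tau d := nest psumcol c d; have c1 : ty c = mone by [].
transitivity (\sum_(d < N) tau d * \sum_(k < i.+1) ecoef k i * mixsum d (q ^ k) m).
  under eq_bigr do rewrite mulr_sumr.
  rewrite exchange_big; apply: eq_bigr => d _ /=.
  rewrite mulr_sumr; apply: eq_bigr => k _; rewrite nest_zetacol_mone//.
  by rewrite /zetacol /= ucmE eqxx muln1 [RHS]mulrC mulrA.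
have hE k d : (k \in ks) ->
    ((-1) ^+ k *: (lam (mone, mkposn (m - q ^ k)) d * h k d))@_(Xq i) =
    tau d * (ecoef k i * psum d (m - q ^ k)) *+ (i < d)%N.
  rewrite mem_filter => /andP[qkm _]; rewrite mcoeffZ lamE expcmn1 mcoeffCM.
  rewrite /h (nest_lam_mone _ c1) mcoeffMC mcoeff_carlitz_word mkposnE ?subn_gt0//.
  case: (i < d)%N; rewrite ?mulr0n ?mulr1n; last by rewrite mul0r !mulr0.
  by rewrite /tau -[RHS]mul1r -[X in _ = X * _](sqrr_sign K k) expr2; ring.
rewrite mcoeffD !raddf_sum /=.
under [X in _ = _ + X]eq_big_seq => k k_ks.
  rewrite scaler_sumr raddf_sum /=; under eq_bigr do rewrite hE//; over.
rewrite exchange_big -big_split; apply: eq_bigr => d _ /=.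
rewrite sum_ecoef_mixsum ?posn_gt0// mulrDr (nest_lam_mone _ c1) mcoeffMC mcoeff_lam.
congr (_ + _); first by rewrite mulrC.
rewrite big_filter (_ : seq.iota 0 m = index_iota 0 m) ?big_mkord; last first.
  by rewrite /index_iota subn0.
by rewrite -sumrMnl mulr_sumr; apply: eq_bigr => k _; rewrite mulrnAr.
Qed.

End OneVariable.
End CarlitzNest.

(** * Truncated zeta functions at the powers of theta *)

Section ZetaValues.
Variables (Fq : finFieldType) (K : fieldType) (iota : {rmorphism {poly Fq} -> K}).
Hypothesis iota_inj : injective iota.
Local Notation psum := (psum iota).
Local Notation mixsum := (mixsum iota).
Local Notation psumcol := (psumcol iota).
Local Notation lam := (lam iota).
Local Notation q := #|Fq|.
Local Notation P := {malg K[{cmonom posn}]}.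

Definition scalar_array (c : array) := ty c = mone.

Lemma scale_nest_nil b N : b *: nest lam [::] N = b%:MP.
Proof.
apply: (etrans (y := b%:MP * 1)); first by rewrite [RHS]mul_malgC.
exact: mulr1.
Qed.

(** The sequences of scalars that are eventually combinations of nested sums of
    trivial type. *)
Definition eventually_nspan (f : nat -> K) := exists g : nat -> P,
  Nspan lam scalar_array g /\ exists D, forall N, (D <= N)%N -> (f N)%:MP = g N.

Lemma nspan_scalar g N : Nspan lam scalar_array g -> g N = ((g N)@_mone)%:MP.
Proof.
move=> [s [sQ sE]]; rewrite sE raddf_sum raddf_sum /=.
apply: eq_big_seq => -[b c] /sQ /= cQ.
by rewrite (nest_lam_mone _ _ cQ) -mul_malgC -mpolyCM malgCK.
Qed.

Lemma eventually_nspan_mcoeff f : eventually_nspan f -> exists g : nat -> P,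
  Nspan lam scalar_array g /\
  exists D, forall N, (D <= N)%N -> (g N)@_mone = f N.
Proof.
move=> [g [gS [D gE]]]; exists g; split=> //; exists D => N DN.
by rewrite -gE// malgCK.
Qed.

Lemma eventually_nspan_psum (n : posn) f : eventually_nspan f ->
  eventually_nspan (fun N => \sum_(d < N) psum d n * f d).
Proof.
move=> [g [gS [D fg]]].
(* f and g only differ below D, which changes the sums by the constant b *)
pose b := \sum_(d < D) psum d n * (f d - (g d)@_mone).
exists (fun N => \sum_(d < N) lam (mone, n) d * g d + b *: nest lam [::] N).
split.
  apply: nspanD.
    by apply: nspan_cons gS => w; rewrite /scalar_array ty_cons /= mul1m.
  by apply/nspanZ/nspan_nest; rewrite /scalar_array /ty big_nil.
exists D => N DN; rewrite scale_nest_nil.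
have -> : \sum_(d < N) lam (mone, n) d * g d =
    (\sum_(d < N) psum d n * (g d)@_mone)%:MP.
  rewrite [RHS]raddf_sum; apply: eq_bigr => d _.
  by rewrite lamE expcmn1 /= mpolyCM -nspan_scalar.
rewrite -raddfD; congr (_%:MP).
rewrite /b (big_ord_widen N (fun d => psum d n * (f d - (g d)@_mone)) DN).
rewrite [X in _ = _ + X]big_mkcond -big_split; apply: eq_bigr => d _ /=.
case: ltnP => [_|Dd]; first by ring.
by rewrite -fg// malgCK addr0.
Qed.

Lemma eventually_nspan_finite (k f : nat -> K) D :
  (forall d, (D <= d)%N -> k d = 0) ->
  eventually_nspan (fun N => \sum_(d < N) k d * f d).
Proof.
move=> k0; exists (fun N => (\sum_(d < D) k d * f d) *: nest lam [::] N); split.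
  by apply/nspanZ/nspan_nest; rewrite /scalar_array /ty big_nil.
exists D => N DN; rewrite scale_nest_nil; congr (_%:MP).
rewrite (big_ord_widen N (fun d => k d * f d) DN) [RHS]big_mkcond.
by apply: eq_bigr => d _; case: ltnP => // Dd; rewrite k0 ?mul0r.
Qed.

Lemma eventually_nspan_sum (I : Type) (r : seq I) (b : I -> K) (f : I -> nat -> K) :
  (forall i, eventually_nspan (f i)) ->
  eventually_nspan (fun N => \sum_(i <- r) b i * f i N).
Proof.
move=> fS; elim: r => [|i r [h [hS [E hE]]]].
  exists (fun=> 0); split; first exact: nspan0.
  by exists 0%N => N _; rewrite big_nil; exact: raddf0.
have [g [gS [D gE]]] := fS i.
exists (fun N => b i *: g N + h N); split.
  by apply: nspanD => //; apply: nspanZ.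
exists (maxn D E) => N; rewrite geq_max => /andP[DN EN].
by rewrite -gE// -hE// big_cons raddfD -mul_malgC -mpolyCM.
Qed.

(** At t_j = theta^(q^k) the letter of weight m that carries t_j becomes the
    power sum of exponent m - q^k, which is a letter of trivial type if
    q^k < m, and vanishes in degrees > k otherwise. *)
Lemma nest_zetacol_span (j : posn) k c : ty c = ucm j ->
  eventually_nspan (nest (zetacol iota j k) c).
Proof.
elim: c => [|[s m] c IHc].
  rewrite /ty big_nil => /(congr1 (fun x : {cmonom posn} => x j)).
  by rewrite cm1 ucmE eqxx.
rewrite ty_cons => /mmul_ucm[[/= -> /IHc cS]|[/= -> c_ty]].
  have zE d : zetacol iota j k (mone, m) d = psum d m.
    by rewrite psumE /zetacol cm1 muln0.
  have := eventually_nspan_psum m cS; congr eventually_nspan.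
  by apply/funext => N; apply: eq_bigr => d _; rewrite zE.
have cS : eventually_nspan (nest psumcol c).
  exists (nest lam c); split; first exact: nspan_nest.
  by exists 0%N => N _; rewrite (nest_lam_mone _ _ c_ty).
have zE d : zetacol iota j k (ucm j, m) d = mixsum d (q ^ k) m.
  by rewrite /zetacol ucmE eqxx muln1.
have cE N : nest (zetacol iota j k) c N = nest psumcol c N.
  exact: nest_zetacol_mone.
have [qkm|mqk] := ltnP (q ^ k) m.
  have := eventually_nspan_psum (mkposn (m - q ^ k)) cS.
  congr eventually_nspan; apply/funext => N; apply: eq_bigr => d _.
  by rewrite cE zE (mixsum_lt iota_inj _ (ltnW qkm)) mkposnE ?subn_gt0.
have k0 d : (k.+1 <= d)%N -> mixsum d (q ^ k) m = 0.
  by move=> kd; rewrite mixsum_gt ?posn_gt0.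
have := eventually_nspan_finite (nest psumcol c) k0.
congr eventually_nspan; apply/funext => N; apply: eq_bigr => d _.
by rewrite cE zE.
Qed.

End ZetaValues.

(** * Limits *)

Section Limits.
Variables (R : realType) (Fq : finFieldType) (C : Cinfty R Fq).
Implicit Types (u v : nat -> C) (x y : C).
Local Notation absC := (Cabs C).
Local Notation cvgC := (cvg_abs absC).

Lemma cvgCP u x : cvgC u x <->
  forall eps : R, 0 < eps -> exists N, forall i, (N <= i)%N -> absC (u i - x) < eps.
Proof.
split=> [/cvgrPdist_lt ux eps eps0|H].
  have [N _ NP] := ux _ eps0; exists N => i /NP.
  by rewrite /= sub0r normrN ger0_norm ?Cabs_ge0.
apply/cvgrPdist_lt => eps /H[N NP]; exists N => // i /= /NP.
by rewrite sub0r normrN ger0_norm ?Cabs_ge0.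
Qed.

Lemma Cabs0 : absC 0 = 0.
Proof. exact/Cabs_eq0. Qed.

Lemma Cabs_gt0 x : x != 0 -> 0 < absC x.
Proof.
move=> x0; rewrite lt_def Cabs_ge0 andbT.
by apply: contra x0 => /eqP/Cabs_eq0->.
Qed.

Lemma Cabs1 : absC 1 = 1.
Proof.
have := @CabsM _ _ C 1 1; rewrite mulr1 => /eqP; rewrite -subr_eq0 -{1}[absC 1]mulr1.
rewrite -mulrBr mulf_eq0 subr_eq0 => /orP[/eqP/Cabs_eq0/eqP|/eqP->//].
by rewrite oner_eq0.
Qed.

Lemma CabsN x : absC (- x) = absC x.
Proof.
have m1 : absC (-1) = 1.
  have := @CabsM _ _ C (-1) (-1); rewrite mulrNN mulr1 Cabs1 -expr2 => /esym/eqP.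
  rewrite sqrf_eq1 => /orP[/eqP//|/eqP m1].
  by have := @Cabs_ge0 _ _ C (-1); rewrite m1 ler0N1.
by rewrite -mulN1r CabsM m1 mul1r.
Qed.

Lemma CabsV x : absC x^-1 = (absC x)^-1.
Proof.
have [->|x0] := eqVneq x 0; first by rewrite invr0 Cabs0 invr0.
apply: (mulfI (lt0r_neq0 (Cabs_gt0 x0))).
by rewrite -CabsM divff// Cabs1 divff// lt0r_neq0// Cabs_gt0.
Qed.

Lemma CabsX x n : absC (x ^+ n) = absC x ^+ n.
Proof. by elim: n => [|n IHn]; rewrite ?Cabs1// !exprS CabsM IHn. Qed.

Lemma CabsD_lt x y e : absC x < e -> absC y < e -> absC (x + y) < e.
Proof. by move=> xe ye; rewrite (le_lt_trans (CabsD _ _))// gt_max xe. Qed.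

Lemma CabsD_le x y e : absC x <= e -> absC y <= e -> absC (x + y) <= e.
Proof. by move=> xe ye; rewrite (le_trans (CabsD _ _))// ge_max xe. Qed.

Lemma Cabs_sum_le (I : eqType) (r : seq I) (F : I -> C) e : 0 <= e ->
  {in r, forall i, absC (F i) <= e} -> absC (\sum_(i <- r) F i) <= e.
Proof.
move=> e0; elim: r => [|i r IHr] Fe; first by rewrite big_nil Cabs0.
rewrite big_cons CabsD_le ?Fe ?mem_head// IHr// => k kr.
by rewrite Fe// inE kr orbT.
Qed.

Lemma CabsB x y : absC (x - y) = absC (y - x).
Proof. by rewrite -CabsN opprB. Qed.

(** In an ultrametric field two limits at distance e > 0 cannot both be at distance
    < e from a term of the sequence. *)
Lemma cvgC_unique u x y : cvgC u x -> cvgC u y -> x = y.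
Proof.
move=> /cvgCP ux /cvgCP uy; apply/eqP; rewrite -subr_eq0.
apply: contraT => /Cabs_gt0 xy.
have [N NP] := ux _ xy; have [M MP] := uy _ xy.
have := NP (maxn N M) (leq_maxl _ _); have := MP (maxn N M) (leq_maxr _ _).
rewrite (CabsB (u _) x) => uyE uxE; have := CabsD_lt uxE uyE.
by rewrite addrA subrK ltxx.
Qed.

Lemma limC_eq u x : cvgC u x -> limC u = x.
Proof.
move=> ux; rewrite /limC; case: xgetP => [y -> uy|/(_ x)//].
exact: cvgC_unique uy ux.
Qed.

Lemma cvgC_near u v x D : (forall i, (D <= i)%N -> u i = v i) ->
  cvgC u x -> cvgC v x.
Proof.
move=> uv /cvgCP ux; apply/cvgCP => e e0; have [N NP] := ux e e0.
exists (maxn N D) => i; rewrite geq_max => /andP[Ni Di].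
by rewrite -uv// NP.
Qed.

Lemma cvgC_cst x : cvgC (fun=> x) x.
Proof. by apply/cvgCP => e e0; exists 0%N => i _; rewrite subrr Cabs0. Qed.

Lemma cvgCD u v x y : cvgC u x -> cvgC v y -> cvgC (fun i => u i + v i) (x + y).
Proof.
move=> /cvgCP ux /cvgCP vy; apply/cvgCP => e e0.
have [N NP] := ux _ e0; have [M MP] := vy _ e0.
exists (maxn N M) => i; rewrite geq_max => /andP[Ni Mi].
by rewrite opprD addrACA CabsD_lt ?NP ?MP.
Qed.

Lemma cvgC_bounded u x : cvgC u x -> exists2 B, 0 < B & forall i, absC (u i) <= B.
Proof.
move=> /cvgCP ux; have [N NP] := ux 1 ltr01.
pose B := 1 + absC x + \sum_(i < N) absC (u i).
have s0 : 0 <= \sum_(i < N) absC (u i) by apply: sumr_ge0 => i _; apply: Cabs_ge0.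
have x0 := @Cabs_ge0 _ _ C x; exists B => [|i]; first by rewrite /B; lra.
have [iN|Ni] := ltnP i N.
  rewrite /B (bigD1 (Ordinal iN))//= [leRHS]addrCA lerDl addr_ge0//; first by lra.
  by apply: sumr_ge0 => k _; apply: Cabs_ge0.
rewrite -[u i](subrK x) CabsD_le//; last by rewrite /B; lra.
by have := NP _ Ni; rewrite /B; lra.
Qed.

Lemma cvgCM u v x y : cvgC u x -> cvgC v y -> cvgC (fun i => u i * v i) (x * y).
Proof.
move=> ux vy; have [B B0 uB] := cvgC_bounded ux.
move/cvgCP : ux => ux; move/cvgCP : vy => vy; apply/cvgCP => e e0.
have y0 : 0 < 1 + absC y by rewrite (lt_le_trans ltr01)// lerDl Cabs_ge0.
have [N NP] := ux _ (divr_gt0 e0 y0); have [M MP] := vy _ (divr_gt0 e0 B0).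
exists (maxn N M) => i; rewrite geq_max => /andP[Ni Mi].
have -> : u i * v i - x * y = u i * (v i - y) + (u i - x) * y by ring.
apply: CabsD_lt; rewrite CabsM.
  rewrite (le_lt_trans (ler_wpM2r (Cabs_ge0 _) (uB i)))//.
  by rewrite -ltr_pdivlMl// mulrC MP.
have := NP _ Ni; rewrite ltr_pdivlMr// => /(le_lt_trans _); apply.
by rewrite ler_wpM2l ?Cabs_ge0// lerDr.
Qed.

Lemma cvgC_sum (I : Type) (r : seq I) (u : I -> nat -> C) (x : I -> C) :
  (forall i, cvgC (u i) (x i)) ->
  cvgC (fun N => \sum_(i <- r) u i N) (\sum_(i <- r) x i).
Proof.
move=> ux; elim: r => [|i r IHr].
  by rewrite big_nil; apply: (cvgC_near (D := 0) _ (cvgC_cst 0)) => N _; rewrite big_nil.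
rewrite big_cons; apply: (cvgC_near (D := 0) _ (cvgCD (ux i) IHr)) => N _.
by rewrite big_cons.
Qed.

Definition nullC u :=
  forall eps : R, 0 < eps -> exists N, forall i, (N <= i)%N -> absC (u i) < eps.

(** In a complete ultrametric field a sequence converges as soon as its
    increments tend to 0. *)
Lemma nullC_incr_cvg u : nullC (fun i => u i.+1 - u i) -> exists x, cvgC u x.
Proof.
move=> u0; apply: Cabs_complete => e e0; have [N NP] := u0 _ e0; exists N.
have uN i : (N <= i)%N -> absC (u i - u N) < e.
  elim: i => [|i IHi].
    by rewrite leqn0 => /eqP->; rewrite subrr Cabs0.
  rewrite leq_eqVlt ltnS => /predU1P[<-|Ni]; first by rewrite subrr Cabs0.
  by rewrite -(subrKA (u i)) CabsD_lt ?NP ?IHi.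
move=> i k Ni Nk; rewrite -(subrKA (u N)) CabsD_lt ?uN//.
by rewrite CabsB uN.
Qed.

End Limits.

(** * Convergence of the nested sums *)

Section Convergence.
Variables (R : realType) (Fq : finFieldType) (C : Cinfty R Fq).
Variables (K : fieldType) (iota : {rmorphism {poly Fq} -> K}).
Variable emb : {rmorphism K -> C}.
Local Notation absC := (Cabs C).
Local Notation cvgC := (cvg_abs absC).
Local Notation psum := (psum iota).
Local Notation lam := (lam iota).
Local Notation q := #|Fq|.
Local Notation P := {malg K[{cmonom posn}]}.
Hypothesis abs_emb : forall a, a != 0 ->
  absC (emb (iota a)) = q%:R ^+ (size a).-1.

Lemma abs_psum_le d n : (0 < n)%N -> absC (emb (psum d n)) <= (q%:R ^+ d)^-1.
Proof.
move=> n0; have q1 : 1 <= q%:R :> R by rewrite ler1n ltnW// card_gt1.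
have q0 : 0 < (q%:R ^+ d : R) by rewrite exprn_gt0// (lt_le_trans ltr01).
rewrite rmorph_sum Cabs_sum_le ?invr_ge0 ?(ltW q0)// => a a_mon.
rewrite fmorphV rmorphXn CabsV CabsX abs_emb ?(monics_neq0 a_mon)//.
move: a_mon; rewrite mem_monics => /andP[_ /eqP->] /=.
rewrite lef_pV2 ?posrE ?(exprn_gt0 n q0)//.
by rewrite ler_eXnr// exprn_ege1.
Qed.

Lemma abs_psum_le1 d n : (0 < n)%N -> absC (emb (psum d n)) <= 1.
Proof.
move=> n0; apply: le_trans (abs_psum_le _ n0) _.
have q1 : 1 <= q%:R :> R by rewrite ler1n ltnW// card_gt1.
by rewrite invf_le1 ?exprn_ege1// exprn_gt0// (lt_le_trans ltr01).
Qed.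

Lemma psum_null n : (0 < n)%N -> nullC (fun d => emb (psum d n)).
Proof.
move=> n0 e e0; exists (Num.bound e^-1) => d Nd.
apply: le_lt_trans (abs_psum_le _ n0) _.
have eN : e^-1 < (Num.bound e^-1)%:R by rewrite archi_boundP// invr_ge0 ltW.
have eq : e^-1 < q%:R ^+ d.
  rewrite (lt_trans eN)// -natrX ltr_nat (leq_ltn_trans Nd)//.
  by rewrite ltn_expl// card_gt1.
have e'0 : 0 < e^-1 by rewrite invr_gt0.
by rewrite -[e]invrK ltf_pV2 ?posrE// (lt_trans e'0).
Qed.

Lemma abs_mcoeffUM (b : K) x (g : P) B nu : 0 <= B ->
  (forall mu, absC (emb g@_mu) <= B) ->
  absC (emb (<< b *g x >> * g)@_nu) <= absC (emb b) * B.
Proof.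
move=> B0 gB; rewrite malgM_def fgmulUg raddf_sum rmorph_sum.
apply: Cabs_sum_le => [|mu _]; first by rewrite mulr_ge0 ?Cabs_ge0.
rewrite /= mcoeffU; case: eqP => _; rewrite ?mulr0n ?mulr1n; last first.
  by rewrite rmorph0 Cabs0 mulr_ge0 ?Cabs_ge0.
by rewrite rmorphM CabsM ler_wpM2l ?Cabs_ge0.
Qed.

(** The bound is uniform in N, although the number of terms grows, because the
    absolute value is ultrametric. *)
Lemma abs_nest_le1 c N nu : absC (emb (nest lam c N)@_nu) <= 1.
Proof.
elim: c N nu => [|a c IHc] N nu.
  rewrite /= mcoeff1; case: eqP => _; first by rewrite rmorph1 Cabs1.
  by rewrite rmorph0 Cabs0.
rewrite nest_cons raddf_sum rmorph_sum Cabs_sum_le// => d _ /=.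
rewrite lamE (le_trans (abs_mcoeffUM _ _ _ ler01 (IHc d)))//.
by rewrite mulr1 abs_psum_le1// posn_gt0.
Qed.

(** The increments are S_N(n) times bounded coefficients. *)
Lemma nest_lam_cvg c nu : exists x, cvgC (fun N => emb (nest lam c N)@_nu) x.
Proof.
case: c => [|a c].
  by exists (emb (nest lam [::] 0)@_nu); exact: (cvgC_cst (emb (nest lam [::] 0)@_nu)).
apply: nullC_incr_cvg => e /(psum_null (posn_gt0 a.2))[N NP].
exists N => i /NP; apply: le_lt_trans.
rewrite -rmorphB -raddfB nestS addrAC subrr add0r lamE.
rewrite (le_trans (abs_mcoeffUM _ _ _ ler01 (abs_nest_le1 c i)))//.
by rewrite mulr1.
Qed.

End Convergence.

(** * Sums over decreasing tuples *)

Section TupleSums.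
Variables (P : comNzRingType) (X : Type) (I : finType) (lev : I -> nat).
Variables (Pd : pred I) (g : X -> I -> P).

Lemma sum_tuple_cons n (F : seq I -> P) (Q : pred (seq I)) :
  \sum_(x : n.+1.-tuple I | Q x) F x =
  \sum_(y : I) \sum_(x : n.-tuple I | Q (y :: x)) F (y :: x).
Proof.
rewrite pair_big_dep /=.
rewrite (reindex (fun p : I * n.-tuple I => [tuple of p.1 :: p.2])) /=.
  by apply: eq_bigl => p.
exists (fun x => (thead x, [tuple of behead x])) => [[y x] _|x _] /=.
  by congr (_, _); apply: val_inj.
by rewrite [RHS]tuple_eta; apply: val_inj.
Qed.

Let desc := fun m n : nat => (n < m)%N.

(** The tuple is split into its head, whose level is the largest degree, and its
    tail, the levels of which are bounded by that of the head. *)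
Lemma sum_tuple_path c M :
  \sum_(x : (size c).-tuple I | all Pd x && path desc M (map lev x))
    \prod_(ai <- zip c x) g ai.1 ai.2 =
  nest (fun a d => \sum_(i | Pd i && (lev i == d)) g a i) c M.
Proof.
elim: c M => [|a c IHc] M.
  rewrite (big_pred1 [tuple]) /= ?big_nil// => x.
  by rewrite [x]tuple0; apply/esym/eqP.
rewrite (sum_tuple_cons _ (fun x => \prod_(ai <- zip (a :: c) x) g ai.1 ai.2)
  (fun x => all Pd x && path desc M (map lev x))) nest_cons.
under [RHS]eq_bigr do rewrite mulr_suml.
rewrite (exchange_big_dep Pd) /= => [|d i _ /andP[]//].
rewrite [RHS]big_mkcond; apply: eq_bigr => i _.
case: ifP => [Pi|_]; last by rewrite big_pred0.
case: (ltnP (lev i) M) => [iM|Mi]; last first.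
  rewrite big_pred0 => [|x]; last by rewrite /desc ltnNge Mi !andbF.
  by rewrite big1// => d /andP[_ /eqP id]; move: (ltn_ord d); rewrite -id ltnNge Mi.
rewrite (big_pred1 (Ordinal iM)) => [|d]; last by rewrite Pi [LHS]eq_sym.
rewrite -IHc mulr_sumr /=; apply: eq_big => x; last by rewrite big_cons.
by rewrite /desc iM.
Qed.

Lemma sum_tuple_sorted (e : rel I) c N : (forall i, Pd i -> (lev i < N)%N) ->
  {in Pd &, forall i k, e i k = (lev k < lev i)%N} ->
  \sum_(x : (size c).-tuple I | all Pd x && sorted e x)
    \prod_(k < size c) g (tnth (in_tuple c) k) (tnth x k) =
  nest (fun a d => \sum_(i | Pd i && (lev i == d)) g a i) c N.
Proof.
move=> levN eE; rewrite -sum_tuple_path; apply: eq_big => [x|x _].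
  apply: andb_id2l => /allP xP.
  have -> : sorted e x = sorted (relpre lev desc) x.
    by apply: (eq_in_sorted (P := Pd)) => //; apply/allP.
  case: (tval x) xP => //= i s iP; rewrite path_map [RHS]andb_idl//.
  by move=> _; apply/levN/iP; rewrite mem_head.
case: c x => [|a c] x; first by rewrite big_ord0 tuple0 big_nil.
rewrite (big_nth (a, thead x)) size_zip size_tuple minnn big_mkord.
apply: eq_bigr => k _; rewrite nth_zip ?size_tuple//=.
by rewrite !(tnth_nth (thead x)) (tnth_nth a).
Qed.

End TupleSums.

Lemma sum_tuple_ord (P : comNzRingType) (X : Type) (phi : X -> nat -> P) c N :
  \sum_(d : (size c).-tuple 'I_N | sorted (fun i k : 'I_N => (k < i)%N) d)
    \prod_(k < size c) phi (tnth (in_tuple c) k) (tnth d k) =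
  nest phi c N.
Proof.
pose psi (a : X) d := \sum_(i : 'I_N | xpredT i && (val i == d)) phi a i.
have psiE w M : (M <= N)%N -> nest psi w M = nest phi w M.
  elim: w M => // a w IHw M MN; rewrite !nest_cons; apply: eq_bigr => d _.
  have -> : psi a d = phi a d.
    by rewrite /psi (big_pred1 (Ordinal (leq_trans (ltn_ord d) MN))).
  by rewrite IHw// (leq_trans _ MN)// ltnW.
rewrite -psiE// -(@sum_tuple_sorted _ _ 'I_N val xpredT (fun a i => phi a i)
  (fun i k => (k < i)%N)) => [|i _|]; [|exact: ltn_ord|by []].
by apply: eq_bigl => d; rewrite all_predT.
Qed.

(** * The series lambda_A and the zeta functions as nested sums *)

Section Concrete.
Variables (R : realType) (Fq : finFieldType) (C : Cinfty R Fq).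
Local Notation q := #|Fq|.
Local Notation K := (ratK Fq).
Local Notation P := {malg K[{cmonom posn}]}.

Definition iotaK : {rmorphism {poly Fq} -> K} := @tofrac {poly Fq}.

Local Notation lam := (lam iotaK).
Local Notation psum := (psum iotaK).

Lemma iotaK_inj : injective iotaK.
Proof. by move=> a b /eqP; rewrite tofrac_eq => /eqP. Qed.

Lemma powersumE d n : powersum Fq d n = psum d n.
Proof. by rewrite /powersum (sum_monics (fun a => a%:F ^- n)). Qed.

Lemma DcarlitzE i : Dcarlitz Fq i = carlitzD iotaK i.
Proof. by []. Qed.

Lemma prod_monalg (I : Type) (r : seq I) (b : I -> K) (x : I -> {cmonom posn}) :
  \prod_(i <- r) << b i *g x i >> =
  << (\prod_(i <- r) b i) *g \big[mmul/mone]_(i <- r) x i >> :> P.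
Proof.
elim: r => [|i r IHr]; first by rewrite !big_nil.
by rewrite !big_cons IHr; exact: monalgM.
Qed.

Lemma lambdaA_nest c nu :
  lambdaA C c nu = limC (fun N => Cemb C (nest lam c N)@_nu).
Proof.
congr limC; apply/funext => N.
rewrite -(sum_tuple_ord lam) raddf_sum rmorph_sum; apply: eq_bigr => d _.
rewrite /=; under [X in Cemb C (mcoeff nu X)]eq_bigr do rewrite lamE.
rewrite [X in mcoeff nu X]prod_monalg mcoeffU rmorphMn -mulr_natr /smonom eq_sym.
by congr (Cemb C _ * _); apply: eq_bigr => k _; rewrite powersumE.
Qed.

Lemma ty_ucm_col (j : posn) (c : array) a : ty c = ucm j -> a \in c ->
  a.1 = mone \/ a.1 = ucm j.
Proof.
elim: c => // b c IHc; rewrite ty_cons inE.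
move=> /mmul_ucm[[b1 c_ty]|[bj c_ty]] /predU1P[->|ac]; [by left| |by right|].
  exact: IHc.
by left; exact: ty_mone c_ty ac.
Qed.

(** The evaluation of a(t) at theta^(q^k) is a(theta)^(q^k), because the
    coefficients of a are fixed by the Frobenius. *)
Lemma theta_eval k (a : {poly Fq}) :
  (map_poly (fun b : Fq => Cemb C b%:P%:F) a).[theta C ^+ (q ^ k)] =
  Cemb C (iotaK a) ^+ (q ^ k).
Proof.
have -> : map_poly (fun b : Fq => Cemb C b%:P%:F) a =
    map_poly (Cemb C) (map_poly (constK iotaK) a).
  by apply/polyP => i; rewrite !coef_map_id0 ?rmorph0// constE.
rewrite /theta -rmorphXn horner_map -rmorphXn; congr (Cemb C _).
rewrite horner_coef size_map_poly.
rewrite (polyK_sum iotaK (leqnn (size a))) (frobenius_sum (constK iotaK)).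
have cE c : constK iotaK c ^+ (q ^ k) = constK iotaK c.
  by rewrite -rmorphXn frob_const.
by apply: eq_bigr => i _; rewrite coef_map exprMn cE exprAC.
Qed.

Definition tpoint (j : posn) k : posn -> C :=
  fun i => if i == j then theta C ^+ (q ^ k) else 0.

Lemma chi_tpoint j k (s : {cmonom posn}) (a : {poly Fq}) : s = mone \/ s = ucm j ->
  chi s a (tpoint j k) = Cemb C (iotaK a) ^+ (q ^ k * s j).
Proof.
rewrite /chi; case=> ->; first by rewrite mdom1 big_seq_fset0 cm1 muln0.
by rewrite mdomU big_seq_fset1 ucmE eqxx expr1 muln1 /tpoint eqxx theta_eval.
Qed.

Lemma zetaA_nest j k c : ty c = ucm j ->
  zetaA c (tpoint j k) = limC (fun N => Cemb C (nest (zetacol iotaK j k) c N)).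
Proof.
move=> c_ty; congr limC; apply/funext => N.
pose g (a : {cmonom posn} * posn) (x : {poly_N Fq}) :=
  chi a.1 x (tpoint j k) / Cemb C (x : {poly Fq})%:F ^+ a.2.
transitivity (nest (fun a d => \sum_(x : {poly_N Fq} |
    ((x : {poly Fq}) \is monic) && ((size x).-1 == d)) g a x) c N).
  rewrite -(@sum_tuple_sorted _ _ {poly_N Fq} (fun x => (size x).-1)
    (fun x => (x : {poly Fq}) \is monic) g (fun b b' => (size b' < size b)%N)).
  - apply: eq_bigl => x; congr (_ && _).
    by apply/forallP/all_tnthP.
  - move=> x x_mon; have := size_npoly x.
    have : (0 < size x)%N by rewrite size_poly_gt0 monic_neq0.
    by case: size.
  - move=> x y x_mon y_mon.
    have : (0 < size x)%N by rewrite size_poly_gt0 monic_neq0.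
    have : (0 < size y)%N by rewrite size_poly_gt0 monic_neq0.
    by case: (size x) => // n; case: (size y).
rewrite (nest_rmorph (Cemb C)); apply: eq_nest => a a_c d dN.
pose h (x : {poly Fq}) := chi a.1 x (tpoint j k) / Cemb C x%:F ^+ posn_nat a.2.
transitivity (\sum_(x <- monics Fq d) h x).
  rewrite -(sum_monics h dN); apply: eq_bigl => x.
  apply: andb_id2l => x_mon.
  have : (0 < size x)%N by rewrite size_poly_gt0 monic_neq0.
  by case: size.
rewrite rmorph_sum; apply: eq_bigr => x _.
rewrite /h (chi_tpoint _ _ (ty_ucm_col c_ty a_c)) rmorphM fmorphV !rmorphXn.
by [].
Qed.

End Concrete.

(** * Powers of the series lambda_A *)

Section Powers.
Variables (R : realType) (Fq : finFieldType) (C : Cinfty R Fq).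
Local Notation q := #|Fq|.
Local Notation K := (ratK Fq).
Local Notation P := {malg K[{cmonom posn}]}.
Local Notation lam := (lam (iotaK Fq)).
Local Notation psum := (psum (iotaK Fq)).

Lemma mdeg_expcmn (s : {cmonom posn}) n : mdeg (expcmn s n) = (n * mdeg s)%N.
Proof.
rewrite /expcmn; case: n => [|n]; first by rewrite mdeg1.
rewrite iteropS; elim: n => [|n IHn]; first by rewrite mul1n.
by rewrite iterS mdegM IHn mulSn.
Qed.

(** Agreement in degrees < D is inherited by products, which reduces powers of
    series to powers in the ring of polynomials. *)
Definition agree D (g : {cmonom posn} -> C) (u : P) :=
  forall nu, (mdeg nu < D)%N -> g nu = Cemb C u@_nu.

Lemma smul_agree D (g h : {cmonom posn} -> C) (u v : P) :
  agree D g u -> agree D h v -> agree D (smul g h) (u * v).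
Proof.
move=> gu hv nu nuD; rewrite /smul mcoeffMl.
pose p := [pred ab : {cmonom posn} * {cmonom posn} | mmul ab.1 ab.2 == nu].
have -> : [set ab | mmul ab.1 ab.2 = nu] = [set` p].
  by apply/seteqP; split=> ab /eqP.
have pD ab : p ab -> (mdeg ab.1 < D)%N /\ (mdeg ab.2 < D)%N.
  by move=> /eqP abnu; move: nuD; rewrite -abnu mdegM; lia.
rewrite -(bigfs _ (r := [seq (a, b) | a <- msupp u, b <- msupp v])).
- rewrite big_mkcond big_allpairs rmorph_sum; apply: eq_big_seq => a a_u.
  rewrite rmorph_sum; apply: eq_big_seq => b b_v /=.
  case: eqP => [ab|_]; last by rewrite mulr0n raddf0.
  have [aD bD] := pD (a, b) (introT eqP ab).
  by rewrite mulr1n rmorphM gu// hv.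
- apply: allpairs_uniq; rewrite ?fset_uniq// => -[a b] [a' b'] _ _ /=.
  by case=> -> ->.
- move=> [a b] /pD[/= aD bD] abr; rewrite gu// hv//.
  (* outside the supports one of the two coefficients is 0 *)
  have [au|/mcoeff_outdom->] := boolP (a \in msupp u); last first.
    by rewrite rmorph0 mul0r.
  have [bv|/mcoeff_outdom->] := boolP (b \in msupp v); last first.
    by rewrite rmorph0 mulr0.
  by case/allpairsP : abr; exists (a, b).
Qed.

Lemma spow_agree D (g : {cmonom posn} -> C) (u : P) k : agree D g u ->
  agree D (spow g k) (u ^+ k).
Proof.
move=> gu; elim: k => [|k IHk].
  by move=> nu _; rewrite /spow /= /smonom expr0 mcoeff1 rmorph_nat.
by rewrite /spow iterS exprS; apply: smul_agree.
Qed.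

(** The term of degree d has total degree >= q^d > d, so the terms with d >= N do
    not contribute. *)
Lemma nest_single_stable (s : {cmonom posn}) n nu N M :
  s != mone -> (mdeg nu < N)%N -> (N <= M)%N ->
  (nest lam [:: (s, n)] M)@_nu = (nest lam [:: (s, n)] N)@_nu.
Proof.
move=> s1 nuN NM; rewrite !nest_cons !raddf_sum /=.
rewrite (big_ord_widen M (fun d => (lam (s, n) d * 1)@_nu) NM) [RHS]big_mkcond.
apply: eq_bigr => d _; case: ltnP => // Nd.
rewrite mulr1 lamE mcoeffU; case: eqP => // /(congr1 mdeg).
rewrite mdeg_expcmn => sE; have s0 : (0 < mdeg s)%N by rewrite lt0n mdeg_eq0.
have := leq_pmulr (q ^ d) s0; rewrite sE leqNgt (ltn_trans nuN)//.
by rewrite (leq_ltn_trans Nd)// ltn_expl// card_gt1.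
Qed.

Lemma lambdaA_single_agree (s : {cmonom posn}) n N : s != mone ->
  agree N (lambdaA C [:: (s, n)]) (nest lam [:: (s, n)] N).
Proof.
move=> s1 nu nuN; rewrite lambdaA_nest; apply: limC_eq.
apply: (cvgC_near (D := N) _ (cvgC_cst _)) => M NM.
by rewrite (nest_single_stable n s1 nuN NM).
Qed.

Lemma spow_lambdaA (j : posn) k :
  spow (lambdaA C [:: (ucm j, posn1)]) (q ^ k) =
  lambdaA C [:: (expcmn (ucm j) (q ^ k), mkposn (q ^ k))].
Proof.
apply/funext => nu; pose N := (mdeg nu).+1.
have j1 : ucm j != mone by rewrite cm1_eq1.
have jq1 : expcmn (ucm j) (q ^ k) != mone.
  rewrite -mdeg_eq0 mdeg_expcmn mdegU muln1.
  by rewrite -lt0n expq_gt0.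
have jA := lambdaA_single_agree posn1 (N := N) j1.
rewrite (lambdaA_single_agree _ (N := N) jq1)// (spow_agree _ jA)//.
by rewrite [X in mcoeff nu X]nest_seq1_frob.
Qed.

End Powers.

(** * The transforms F and E *)

Section Final.
Variables (R : realType) (Fq : finFieldType) (C : Cinfty R Fq).
Local Notation q := #|Fq|.
Local Notation K := (ratK Fq).
Local Notation P := {malg K[{cmonom posn}]}.
Local Notation iotaK := (iotaK Fq).
Local Notation iotaK_inj := (@iotaK_inj Fq).
Local Notation lam := (lam iotaK).
Local Notation psum := (psum iotaK).
Local Notation ecoef := (ecoef iotaK).
Local Notation cvgC := (cvg_abs (Cabs C)).
Local Notation emb := (Cemb C).

(** limC is a genuine limit in lambdaA, and not its default value 0. *)
Lemma lambdaA_cvg c nu :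
  cvgC (fun N => emb (nest lam c N)@_nu) (lambdaA C c nu).
Proof.
have [|x xP] := @nest_lam_cvg R Fq C K iotaK emb _ c nu.
  by move=> a a0; exact: Cabs_emb.
by rewrite lambdaA_nest (limC_eq xP).
Qed.

(** CK_sub with lists in place of finite families, and for any condition on the
    arrays. *)
Definition array_comb (Q : array -> Prop) (x : CK Fq) :=
  exists s : seq (K * array), {in s, forall bc, Q bc.2} /\
    x = \sum_(bc <- s) bc.1 *: << bc.2 >>.

Lemma array_comb_supp Q x c : array_comb Q x -> x@_c != 0 -> Q c.
Proof.
move=> [s [sQ ->]]; rewrite raddf_sum /= => H.
have [bc bc_s /eqP <-] : exists2 bc, bc \in s & bc.2 == c.
  apply/hasP; apply: contraNT H => /hasPn sc.
  by rewrite big_seq big1// => bc /sc bcc; rewrite mcoeffZ mcoeffU (negPf bcc) mulr0.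
exact: sQ.
Qed.

Lemma array_comb_sub n Sg x : array_comb (admissible Sg n) x -> CK_sub n Sg x.
Proof.
move=> [s [sQ ->]]; exists (size s), (fun i => (tnth (in_tuple s) i).1).
exists (fun i => (tnth (in_tuple s) i).2); split=> [i|]; last by rewrite [LHS]big_tnth.
exact/sQ/mem_tnth.
Qed.

Lemma lambdaK_sum (s : seq (K * array)) nu :
  lambdaK C (\sum_(bc <- s) bc.1 *: << bc.2 >>) nu =
  \sum_(bc <- s) emb bc.1 * lambdaA C bc.2 nu.
Proof.
elim: s => [|bc s IHs].
  by rewrite !big_nil /lambdaK msupp0 big_seq_fset0.
by rewrite !big_cons lambdaK_linear lambdaK_basis IHs.
Qed.

Lemma nspan_lambdaK Q g : Nspan lam Q g -> exists2 x, array_comb Q x &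
  forall nu, cvgC (fun N => emb (g N)@_nu) (lambdaK C x nu).
Proof.
move=> [s [sQ sE]]; exists (\sum_(bc <- s) bc.1 *: << bc.2 >>).
  by exists s.
move=> nu; rewrite lambdaK_sum.
have := cvgC_sum s (fun bc => cvgCM (cvgC_cst (emb bc.1)) (lambdaA_cvg bc.2 nu)).
apply: (cvgC_near (D := 0)) => N _.
rewrite sE raddf_sum rmorph_sum; apply: eq_bigr => bc _.
by rewrite /= mcoeffZ rmorphM.
Qed.

Section ZetaCombination.
Variables (j : posn) (I : Type) (r : seq I) (b : I -> K) (c : I -> array).
Hypothesis c_ty : forall i, ty (c i) = ucm j.

(** The value at t_j = theta^(q^k) of a combination of zeta functions,
    truncated to the monic polynomials of degree < N. *)
Definition ztrunc k N : K := \sum_(i <- r) b i * nest (zetacol iotaK j k) (c i) N.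

(** The truncations are eventually combinations of truncated multiple zeta values,
    of which convergence is known. *)
Lemma zetacol_cvg k d : ty d = ucm j ->
  cvgC (fun N => emb (nest (zetacol iotaK j k) d N)) (zetaA d (tpoint C j k)).
Proof.
move=> d_ty; have [g [gS [D gE]]] :=
    eventually_nspan_mcoeff (nest_zetacol_span iotaK_inj k d_ty).
have [x _ /(_ mone) gx] := nspan_lambdaK gS.
have nx : cvgC (fun N => emb (nest (zetacol iotaK j k) d N)) (lambdaK C x mone).
  by apply: (cvgC_near (D := D) _ gx) => N DN; rewrite gE.
by rewrite zetaA_nest// (limC_eq nx).
Qed.

Lemma ztrunc_cvg k :
  cvgC (fun N => emb (ztrunc k N))
    (\sum_(i <- r) emb (b i) * zetaA (c i) (tpoint C j k)).
Proof.
have := cvgC_sum r (fun i => cvgCM (cvgC_cst (emb (b i))) (zetacol_cvg k (c_ty i))).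
apply: (cvgC_near (D := 0)) => N _.
by rewrite rmorph_sum; apply: eq_bigr => i _; rewrite rmorphM.
Qed.

End ZetaCombination.

Lemma ecoefE k i : (k <= i)%N ->
  emb (ecoef k i) = (emb (Dcarlitz Fq k * lcarlitz Fq (i - k) ^+ (q ^ k)))^-1.
Proof. by move=> ki; rewrite /ecoef ki fmorphV. Qed.

Lemma Fcoef_ecoef (f : C -> C) i :
  Fcoef f i = \sum_(k < i.+1) f (theta C ^+ (q ^ k)) * emb (ecoef k i).
Proof. by apply: eq_bigr => k _; rewrite ecoefE// -ltnS. Qed.

Section OneVariable.
Variable j : posn.
Local Notation Xq i := (expcmn (ucm j) (q ^ i)).

Lemma calF_Xq (f : C -> C) i : calF j f (Xq i) = Fcoef f i.
Proof.
apply: limC_eq; apply: (cvgC_near (D := i.+1) _ (cvgC_cst _)) => N iN.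
rewrite (bigD1 (Ordinal iN))//= /smonom eqxx mulr1 big1 ?addr0// => k.
rewrite -val_eqE /= => ki.
rewrite (inj_eq (@expcmn_ucm_inj j)) eqn_exp2l ?card_gt1// eq_sym (negPf ki).
by rewrite mulr0.
Qed.

Lemma calF_out (f : C -> C) nu : (forall i, nu != Xq i) -> calF j f nu = 0.
Proof.
move=> nuX; apply: limC_eq; apply: (cvgC_near (D := 0) _ (cvgC_cst _)) => N _.
by rewrite big1// => i _; rewrite /smonom (negPf (nuX i)) mulr0.
Qed.

Local Notation Lam k := (lambdaA C [:: (Xq k, mkposn (q ^ k))]).

Lemma Lam_val k nu N : (mdeg nu < N)%N -> Lam k nu =
  \sum_(d < N) emb (psum d (q ^ k)) *+ (Xq (k + d) == nu).
Proof.
move=> nuN; rewrite (@lambdaA_single_agree R Fq C _ _ N) //; last first.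
  by rewrite -mdeg_eq0 mdeg_expcmn mdegU muln1 -lt0n expq_gt0.
rewrite nest_seq1 raddf_sum rmorph_sum; apply: eq_bigr => d _.
by rewrite /= lamE mcoeffU rmorphMn mkposnE ?expq_gt0// expcmn_mul expnD.
Qed.

Lemma Lam_out k nu : (forall i, nu != Xq i) -> Lam k nu = 0.
Proof.
move=> nuX; rewrite (Lam_val k (ltnSn _)) big1// => d _.
by rewrite eq_sym (negPf (nuX _)).
Qed.

(** This is S_(i-k)(q^k), and S_d(q^k) = S_d(1)^(q^k) = l_d^(-q^k). *)
Lemma Lam_Xq k i : Lam k (Xq i) =
  if (k <= i)%N then emb ((carlitzL iotaK (i - k))^-1 ^+ (q ^ k)) else 0.
Proof.
rewrite (Lam_val k (ltnSn _)) mdeg_expcmn mdegU muln1.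
have E d : (Xq (k + d) == Xq i) = (k + d == i)%N.
  by rewrite (inj_eq (@expcmn_ucm_inj j)) eqn_exp2l ?card_gt1.
under eq_bigr do rewrite E.
case: leqP => [ki|ik]; last first.
  by rewrite big1// => d _; rewrite gtn_eqF// ltn_addr.
have ikq : (i - k < (q ^ i).+1)%N.
  by rewrite ltnS (leq_trans (leq_subr _ _))// ltnW// ltn_expl// card_gt1.
rewrite (bigD1 (Ordinal ikq))//= subnKC// eqxx mulr1n big1 ?addr0 => [|d].
  by rewrite -[(q ^ k)%N in LHS]mul1n -psum_frob (psum1 iotaK_inj).
by rewrite -val_eqE /= => dik; rewrite [_ == _]negbTE//; apply: contra dik; lia.
Qed.

Lemma calE_term (f : C -> C) k nu :
  f (theta C ^+ (q ^ k)) / emb (Dcarlitz Fq k)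
    * spow (lambdaA C [:: (ucm j, posn1)]) (q ^ k) nu =
  f (theta C ^+ (q ^ k)) * emb (Dcarlitz Fq k)^-1 * Lam k nu.
Proof. by rewrite spow_lambdaA fmorphV. Qed.

Lemma calE_Xq (f : C -> C) i : calE j f (Xq i) = Fcoef f i.
Proof.
apply: limC_eq; apply: (cvgC_near (D := i.+1) _ (cvgC_cst _)) => N iN.
pose F k := f (theta C ^+ (q ^ k)) * emb (ecoef k i).
rewrite Fcoef_ecoef (big_ord_widen N F iN) big_mkcond.
apply: eq_bigr => k _; rewrite calE_term Lam_Xq ltnS; case: leqP => ki.
  by rewrite /F -mulrA -rmorphM ecoefE// -fmorphV invfM exprVn.
by rewrite mulr0.
Qed.

Lemma calE_out (f : C -> C) nu : (forall i, nu != Xq i) -> calE j f nu = 0.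
Proof.
move=> nuX; apply: limC_eq; apply: (cvgC_near (D := 0) _ (cvgC_cst _)) => N _.
by rewrite big1// => k _; rewrite calE_term Lam_out ?mulr0.
Qed.

(** Both series have coefficient Fcoef f i at X_j^(q^i) and no other terms. *)
Lemma calF_calE (f : C -> C) : calF j f = calE j f.
Proof.
apply/funext => nu; have [[i ->]|nuX] := pselect (exists i, nu = Xq i).
  by rewrite calF_Xq calE_Xq.
have {}nuX i : nu != Xq i by apply/eqP => nuE; apply: nuX; exists i.
by rewrite calF_out// calE_out.
Qed.

End OneVariable.

End Final.

(** * The relation *)

Section Relation.
Variables (R : realType) (Fq : finFieldType) (C : Cinfty R Fq).
Local Notation q := #|Fq|.
Local Notation K := (ratK Fq).
Local Notation P := {malg K[{cmonom posn}]}.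
Local Notation iotaK := (iotaK Fq).
Local Notation iotaK_inj := (@iotaK_inj Fq).
Local Notation lam := (lam iotaK).
Local Notation ecoef := (ecoef iotaK).
Local Notation cvgC := (cvg_abs (Cabs C)).
Local Notation emb := (Cemb C).
Variables (j : posn) (n : nat) (f : C -> C).
Local Notation Xq i := (expcmn (ucm j) (q ^ i)).
Local Notation Lam k := (lambdaA C [:: (Xq k, mkposn (q ^ k))]).
Variables (I : Type) (r : seq I) (b : I -> K) (c : I -> array).
Hypothesis c_adm : forall i, admissible (ucm j) n (c i).
Hypothesis f_zeta : forall k,
  f (theta C ^+ (q ^ k)) = \sum_(i <- r) emb (b i) * zetaA (c i) (tpoint C j k).

Let c_ty i : ty (c i) = ucm j.
Proof. by case: (c_adm i). Qed.

Lemma f_cvg k : cvgC (fun N => emb (ztrunc j r b c k N)) (f (theta C ^+ (q ^ k))).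
Proof. by rewrite f_zeta; apply: ztrunc_cvg. Qed.

(** For each truncation the combination of the zeta functions is turned by
    F_zeta_span into a combination of nested sums; lambdaK x is the limit of the
    latter, and the Fcoef f i are the limits of the former. *)
Lemma calF_lambdaK : exists2 x : CK Fq,
  array_comb (admissible (ucm j) n) x & lambdaK C x = calF j f.
Proof.
have [G GP] := choice (fun i => F_zeta_span iotaK_inj (c_adm i)).
have gS : Nspan lam (admissible (ucm j) n) (fun N => \sum_(i <- r) b i *: G i N).
  elim: (r) => [|i s IHs].
    by apply: nspan_ext (nspan0 _ _) => N; rewrite big_nil.
  apply: nspan_ext (nspanD (nspanZ (b i) (GP i).1) IHs) => N.
  by rewrite big_cons.
have [x xS xP] := nspan_lambdaK C gS; exists x => //.
apply/funext => nu; have [[i ->]|nuX] := pselect (exists i, nu = Xq i).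
  rewrite calF_Xq Fcoef_ecoef; apply: cvgC_unique (xP _) _.
  have := cvgC_sum (index_enum 'I_i.+1)
    (fun k => cvgCM (f_cvg k) (cvgC_cst (emb (ecoef k i)))).
  apply: (cvgC_near (D := 0)) => N _.
  rewrite raddf_sum rmorph_sum.
  under eq_bigr do rewrite -rmorphM /ztrunc mulr_suml rmorph_sum.
  rewrite exchange_big; apply: eq_bigr => m _ /=.
  rewrite mcoeffZ -(GP m).2 mulr_sumr rmorph_sum.
  by apply: eq_bigr => k _; rewrite -mulrA [_ * ecoef _ _]mulrC.
have {}nuX i : nu != Xq i by apply/eqP => nuE; apply: nuX; exists i.
rewrite calF_out//; apply: cvgC_unique (xP _) _.
apply: (cvgC_near (D := 0) _ (cvgC_cst 0)) => N _.
have [s [sQ ->]] := gS.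
rewrite raddf_sum big_seq big1 ?raddf0// => -[a w] /sQ[w_ty _].
by rewrite /= mcoeffZ (mcoeff_nest_out _ _ w_ty nuX) mulr0.
Qed.

(** f(theta^(q^k)) is the limit of a combination of nested sums of trivial type,
    which is multiplied with the nested sum of a single letter before the limit is
    taken. *)
Lemma Lam_term k : exists2 y : CK Fq, array_comb (fun w => ty w = Xq k) y &
  forall nu, lambdaK C y nu = f (theta C ^+ (q ^ k)) * Lam k nu.
Proof.
have [g [gS [D gE]]] : eventually_nspan iotaK (ztrunc j r b c k).
  apply: eventually_nspan_sum => i; exact: (nest_zetacol_span iotaK_inj k (c_ty i)).
pose a : array := [:: (Xq k, mkposn (q ^ k))].
have hS : Nspan lam (fun w => ty w = Xq k) (fun N => g N * nest lam a N).
  apply: nspan_mul gS (nspan_nest _ (erefl a)) => w _ w_ty <-.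
  apply: nspan_sub (nspan_nest_mul (lam_mul iotaK_inj) w a) => v [v_ty _].
  by rewrite [LHS]v_ty [ty w]w_ty mul1m /ty big_seq1.
have [y yS yP] := nspan_lambdaK C hS; exists y => // nu.
apply: cvgC_unique (yP nu) _.
have := cvgCM (f_cvg k) (lambdaA_cvg C a nu).
apply: (cvgC_near (D := D)) => N DN.
by rewrite -gE// mcoeffCM rmorphM.
Qed.

(** The types q^k {j} being distinct, the terms with different k cannot cancel in
    y. *)
Lemma calE_lambdaK M : (forall k, (M <= k)%N -> f (theta C ^+ (q ^ k)) = 0) ->
  exists y : CK Fq, lambdaK C y = calE j f /\
  forall k, f (theta C ^+ (q ^ k)) != 0 -> exists2 w, ty w = Xq k & y@_w != 0.
Proof.
move=> fM.
have [Y YP] := choice (fun k => let: ex_intro2 y yS yP := Lam_term k in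
  ex_intro (fun y => array_comb (fun w => ty w = Xq k) y /\
    forall nu, lambdaK C y nu = f (theta C ^+ (q ^ k)) * Lam k nu) y (conj yS yP)).
pose y := \sum_(k < M) (Dcarlitz Fq k)^-1 *: Y k.
have yE nu : lambdaK C y nu =
    \sum_(k < M) emb (Dcarlitz Fq k)^-1 * lambdaK C (Y k) nu.
  rewrite /y; elim: (index_enum _) => [|k s IHs].
    by rewrite !big_nil /lambdaK msupp0 big_seq_fset0.
  by rewrite !big_cons lambdaK_linear IHs.
exists y; split.
  apply/funext => nu; rewrite yE; apply/esym/limC_eq.
  apply: (cvgC_near (D := M) _ (cvgC_cst _)) => N MN.
  pose F k := emb (Dcarlitz Fq k)^-1 * lambdaK C (Y k) nu.
  rewrite (big_ord_widen N F MN) big_mkcond; apply: eq_bigr => k _.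
  rewrite calE_term; case: ltnP => kM; last by rewrite fM// !mul0r.
  by rewrite /F (YP k).2 mulrCA mulrA.
move=> k fk0; have kM : (k < M)%N.
  by rewrite ltnNge; apply: contra fk0 => /fM->.
have yw w : ty w = Xq k -> y@_w = (Dcarlitz Fq k)^-1 * (Y k)@_w.
  move=> w_ty; rewrite raddf_sum (bigD1 (Ordinal kM))//= [X in _ + X]big1.
    by rewrite addr0 mcoeffZ.
  move=> i; rewrite -val_eqE /= => ik; rewrite mcoeffZ.
  have [->|] := eqVneq (Y i)@_w 0; first by rewrite mulr0.
  move/(array_comb_supp (YP i).1); rewrite w_ty => /expcmn_ucm_inj/eqP.
  by rewrite eqn_exp2l ?card_gt1// eq_sym (negPf ik).
have Yk0 : Y k != 0.
  apply: contra_neq fk0 => Yk0; have := (YP k).2 (Xq k).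
  rewrite Yk0 /lambdaK msupp0 big_seq_fset0 Lam_Xq leqnn subnn carlitzL0.
  by rewrite invr1 expr1n rmorph1 mulr1.
have [w Yw0] : exists w, (Y k)@_w != 0.
  apply: contra_notP (elimN eqP Yk0) => H; apply/malgP => w; rewrite mcoeff0.
  by apply/eqP; apply: contra_notT H => ?; exists w.
exists w; first exact: array_comb_supp (YP k).1 Yw0.
rewrite yw; last exact: array_comb_supp (YP k).1 Yw0.
by apply: mulf_neq0 Yw0; rewrite invr_eq0 DcarlitzE; exact: (carlitzD_neq0 iotaK_inj).
Qed.

End Relation.

Lemma finite_set_nat_bound (A : set nat) : finite_set A ->
  exists M, forall i, (M <= i)%N -> ~ A i.
Proof.
move=> /finite_seqP[s ->]; exists (\max_(i <- s) i).+1 => i /= Mi i_s.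
have : (i <= \max_(k <- s) k)%N by apply: (leq_bigmax_seq (F := id)).
by rewrite leqNgt Mi.
Qed.

Theorem theoremB (R : realType) (p e : nat) (Fq : finFieldType)
    (p_prime : prime p) (e_gt0 : (0 < e)%N) (cardFq : #|Fq| = (p ^ e)%N)
    (C : Cinfty R Fq) (j n : posn) (f : C -> C) (f_triv : Ztriv p n j f)
    (f_neq0 : exists2 i : nat, (0 < i)%N & f (theta C ^+ (#|Fq| ^ i)) != 0) :
  exists x y : CK Fq,
    [/\ CK_sub n (ucm j) x,
        lambdaK C x = calF j f,
        calF j f = calE j f,
        calE j f = lambdaK C y
      & [/\ x <> y, x - y <> 0 & lambdaK C (x - y) = (fun=> 0)]].
Proof.
case: f_triv => -[g [m [b [c [c_adm gE]]]] fE] /finite_set_nat_bound[M fM].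
have f_zeta k : f (theta C ^+ (#|Fq| ^ k)) =
    \sum_(i < m) Cemb C (b i : nat)%:R * zetaA (c i) (tpoint C j k).
  by rewrite fE gE /fun_of_var; apply: eq_bigr => i _; rewrite rmorph_nat.
have [x xS xF] := calF_lambdaK c_adm f_zeta.
have fM0 k : (M <= k)%N -> f (theta C ^+ (#|Fq| ^ k)) = 0.
  by move=> /fM /negP; rewrite negbK => /eqP.
have [y [yE yP]] := calE_lambdaK c_adm f_zeta fM0.
have xy : x <> y.
  case: f_neq0 => i i0 /yP[w w_ty]; move=> yw0 xyE.
  move: yw0; rewrite -xyE => /(array_comb_supp xS)[wj _].
  move: w_ty; rewrite /ty wj -{1}[ucm j]/(expcmn (ucm j) 1) => /expcmn_ucm_inj.
  by move/eqP; rewrite -{1}(expn0 #|Fq|) eqn_exp2l ?card_gt1// eq_sym gtn_eqF.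
exists x, y; split=> //.
- exact: array_comb_sub.
- exact: calF_calE.
split=> //; first by move/subr0_eq.
have -> : x - y = (-1) *: y + x by rewrite scaleN1r addrC.
rewrite lambdaK_linear yE xF -calF_calE; apply/funext => nu.
by rewrite rmorphN1 mulN1r addNr.
Qed.
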